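(* Let $\mathsf{N}$ be a positive integer and $\mathsf{T},\mathsf{E}$ non-negative integers with $\mathsf{N}\ge \mathsf{T}+\mathsf{E}+1$, and let $\eta\ge 0$ and $\epsilon>0$. Then for every $\gamma>0$ there exists a secure multiplication coding scheme $\mathcal{C}$ (with no adversarial nodes, i.e. $\mathsf{A}=0$, and at most $\mathsf{E}$ erasures) that satisfies $\mathsf{T}$-node $\epsilon$-DP and whose mean square error satisfies $$\mathtt{MSE}(\mathcal{C})\le \frac{\eta^2}{\left(1+\mathtt{SNR}^*\right)^2}+\gamma,\qquad \text{where } \mathtt{SNR}^*=\frac{\eta}{(\sigma^*(\epsilon))^2}.$$
   Context: System model: $\mathsf{N}$ computation nodes jointly estimate $AB$, where $A,B\in\mathbb{R}$ are statistically independent random variables with $\mathbb{E}[A^2]\le\eta$, $\mathbb{E}[B^2]\le\eta$. A coding scheme $\mathcal{C}$ specifies a joint distribution of real random variables $\{\tilde R_i,\tilde S_i\}_{i=1}^{\mathsf{N}}$, independent of $(A,B)$, with zero means, with the family $\{\tilde R_i\}$ independent of the family $\{\tilde S_i\}$, together with a decoding function $d:(\mathbb{R}\cup\{\varepsilon\})^{\mathsf{N}}\to\mathbb{R}$ ($\varepsilon$ is an erasure symbol); $d$ may depend on the noise distribution and on $\mathsf{N},\mathsf{E},\mathsf{A},\eta$. Node $i$ stores $\tilde A_i=A+\tilde R_i$, $\tilde B_i=B+\tilde S_i$ and outputs $\tilde C_i=\tilde A_i\tilde B_i$. For an erased set $\mathcal{E}\subseteq[\mathsf{N}]$ with $|\mathcal{E}|\le\mathsf{E}$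 and adversarial set $\mathcal{A}\subseteq[\mathsf{N}]$ with $|\mathcal{A}|\le\mathsf{A}$, $\mathcal{Y}_{\mathcal{E},\mathcal{A}}$ is the set of vectors $\mathbf{Y}=(Y_1,\dots,Y_{\mathsf{N}})\in(\mathbb{R}\cup\{\varepsilon\})^{\mathsf{N}}$ with $Y_i=\tilde C_i$ for $i\notin\mathcal{E}\cup\mathcal{A}$ and $Y_i=\varepsilon$ for $i\in\mathcal{E}$ (entries for $i\in\mathcal{A}\setminus\mathcal{E}$ are arbitrary reals). The mean square error is $\mathtt{MSE}(\mathcal{C})=\sup_{|\mathcal{E}|\le\mathsf{E},|\mathcal{A}|\le\mathsf{A}}\mathbb{E}\big[\sup_{\mathbf{Y}\in\mathcal{Y}_{\mathcal{E},\mathcal{A}}}(d(\mathbf{Y})-AB)^2\big]$. $\mathsf{T}$-node $\epsilon$-DP: for all $A_0,A_1,B_0,B_1\in\mathbb{R}$ with $|A_0-A_1|\le1$, $|B_0-B_1|\le1$, every $\mathcal{T}=\{t_1,\dots,t_{\mathsf{T}}\}\subseteq[\mathsf{N}]$ and every Borel $\mathcal{B}\subseteq\mathbb{R}^{\mathsf{T}}$, $\mathbb{P}(\mathbf{Y}^{(0)}_{\mathcal{T}}\in\mathcal{B})\le e^{\epsilon}\mathbb{P}(\mathbf{Y}^{(1)}_{\mathcal{T}}\in\mathcal{B})$ and $\mathbb{P}(\mathbf{Z}^{(0)}_{\mathcal{T}}\in\mathcal{B})\le e^{\epsilon}\mathbb{P}(\mathbf{Z}^{(1)}_{\mathcal{T}}\in\mathcal{B})$,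 where $\mathbf{Y}^{(\ell)}_{\mathcal{T}}=(A_\ell+\tilde R_{t_1},\dots,A_\ell+\tilde R_{t_{\mathsf{T}}})$ and $\mathbf{Z}^{(\ell)}_{\mathcal{T}}=(B_\ell+\tilde S_{t_1},\dots,B_\ell+\tilde S_{t_{\mathsf{T}}})$. $(\sigma^*(\epsilon))^2$ is the infimum of $\mathrm{Var}(X)$ over finite-variance real random variables $X$ such that $\mathbb{P}(X'+X\in\mathcal{B})\le e^{\epsilon}\mathbb{P}(X''+X\in\mathcal{B})$ for all reals $|X'-X''|\le1$ and Borel $\mathcal{B}\subseteq\mathbb{R}$; explicitly $(\sigma^*(\epsilon))^2=\frac{2^{2/3}e^{-2\epsilon/3}(1+e^{-2\epsilon/3})+e^{-\epsilon}}{(1-e^{-\epsilon})^2}$. *)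

(* Defs.v *)
From HB Require Import structures.
From mathcomp Require Import all_boot all_order all_algebra.
From mathcomp Require Import all_classical all_reals all_analysis.
Set Implicit Arguments. Unset Strict Implicit. Unset Printing Implicit Defensive.
Import Order.TTheory GRing.Theory Num.Theory.
Import numFieldNormedType.Exports.
Local Open Scope classical_set_scope.
Local Open Scope ring_scope.

Definition noise_DP1 (R : realType) (eps : R) (mu : probability R R) : Prop :=
  forall x' x'' : R, `|x' - x''| <= 1 ->
  forall B : set R, measurable B ->
    (mu [set x : R | B (x' + x)%R] <= (expR eps)%:E * mu [set x : R | B (x'' + x)%R])%E.

Definition finite_variance (R : realType) (mu : probability R R) : Prop :=
  mu.-integrable setT (fun x : R => (x ^+ 2)%:E).

Definition variance_of (R : realType) (mu : probability R R) : R :=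
  fine (\int[mu]_x (x ^+ 2)%:E)%E - (fine (\int[mu]_x x%:E)%E) ^+ 2.

Definition sigma_star_sq (R : realType) (eps : R) : R :=
  inf [set variance_of mu | mu in [set mu : probability R R |
                                   finite_variance mu /\ noise_DP1 eps mu]].

Definition SNR_star (R : realType) (eta eps : R) : R := eta / sigma_star_sq eps.

Definition borel_vec (R : realType) (n : nat) : set (set ('I_n -> R)) :=
  <<s [set [set x : 'I_n -> R | forall j, Bs j (x j)] |
        Bs in [set Bs : 'I_n -> set R | forall j, measurable (Bs j)]] >>.

Definition T_node_DP (R : realType) (N T : nat) (eps : R)
    d (Om : measurableType d) (Q : probability Om R) (Z : 'I_N -> Om -> R) : Prop :=
  forall t : 'I_T -> 'I_N, injective t ->
  forall x0 x1 : R, `|x0 - x1| <= 1 ->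
  forall B : set ('I_T -> R), borel_vec B ->
    (Q [set w | B (fun j => x0 + Z (t j) w)%R]
       <= (expR eps)%:E * Q [set w | B (fun j => x1 + Z (t j) w)%R])%E.

Definition zero_mean_family (R : realType) (N : nat)
    d (Om : measurableType d) (Q : probability Om R) (Z : 'I_N -> Om -> R) : Prop :=
  forall i, measurable_fun setT (Z i) /\
            Q.-integrable setT (fun w => (Z i w)%:E) /\
            (\int[Q]_w (Z i w)%:E = 0)%E.

Definition received (R : realType) (N : nat) (Er : {set 'I_N})
    (a b : R) (Rn Sn : 'I_N -> R) : 'I_N -> option R :=
  fun i => if i \in Er then None else Some ((a + Rn i) * (b + Sn i)).

(* Main.v *)
Require Import Defs.
From HB Require Import structures.
From mathcomp Require Import all_boot all_order all_algebra.
From mathcomp Require Import all_classical all_reals all_analysis.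
From mathcomp Require Import qpoly measurable_realfun zify ring lra.
Set Implicit Arguments. Unset Strict Implicit. Unset Printing Implicit Defensive.
Import Order.TTheory GRing.Theory Num.Theory.
Import numFieldNormedType.Exports.
Local Open Scope classical_set_scope.
Local Open Scope ring_scope.

(** Let U = A + z_0 and V = B + y_0 with z_0, y_0 nearly optimal noise.  From
    U V and from U V - (U y_0 + V z_0) = A B - z_0 y_0 one recovers
    A B - (A - alpha U)(B - alpha V) by a linear combination, where alpha U is
    the linear MMSE estimate of A; the error is the product of two independent
    MMSE errors.  Node i stores A + z_0 perturbed by a term s^3 z_0 and by
    independent noises of scale s^2.  Any T nodes see at most z_0 and the noise
    of scale s^2, which drowns the term s^3 z_0, so a small margin in the
    privacy of z_0 suffices.  In the products of T + 1 nodes the terms linear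
    in the perturbation can be solved for by interpolation, and the quadratic
    ones, of order s^4, are negligible against s^3. *)


(** The linear combination comes from $AB-(A-\alpha U)(B-\alpha
    V)=(2\alpha-\alpha^2)UV-\alpha(Uy_0+Vz_0)$. The obstacle is privacy: a nearly optimal $z_0$ may
    spend the whole budget $\epsilon$, leaving nothing for the other layers. Neither a formula for
    [sigma_star_sq] nor its continuity in $\epsilon$ is invoked; a little variance is traded for a
    constant [theta] strictly below $e^\epsilon$, and the gap pays for the other layers. Joint
    densities of the noise are avoided. The noise is linear in $T$ independent coordinates, so a
    change of the input seen by $T$ nodes equals a bounded shift of these coordinates, and the price
    is the product of the one-dimensional prices. No limit is taken either: one $s$ is fixed in
    advance, uniformly over the erased sets and over the laws of $A$ and $B$, which enter through
    their second moments only. *)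

(** * Pushforwards, mixtures and translations of measures *)

Lemma pushforward_probability (R : realType) d (T : measurableType d)
    (P : probability T R) (X : T -> R) :
  measurable_fun setT X ->
  exists P' : probability R R, P' = pushforward P X :> (set R -> \bar R).
Proof.
move=> mX.
pose X' : {mfun T >-> R} := HB.pack X (isMeasurableFun.Build _ _ _ _ _ mX).
by exists (distribution P X').
Qed.

Lemma mixture_probability (R : realType) (P1 P2 : probability R R) (p : R) :
  0 <= p <= 1 ->
  exists P : probability R R,
    (forall D, measurable D -> P D = (1 - p)%:E * P1 D + p%:E * P2 D)%E /\
    (forall f : R -> \bar R, measurable_fun [set: R] f -> (forall x, 0 <= f x)%E ->
       \int[P]_x f x = (1 - p)%:E * \int[P1]_x f x + p%:E * \int[P2]_x f x)%E.
Proof.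
move=> /andP[p0 p1].
have q0 : 0 <= 1 - p by rewrite subr_ge0.
pose m := measure_add (mscale (NngNum q0) P1) (mscale (NngNum p0) P2).
have mE D : m D = ((1 - p)%:E * P1 D + p%:E * P2 D)%E.
  by rewrite /m measure_addE.
have m1 : m setT = 1%E.
  by rewrite mE !probability_setT !mule1 -EFinD subrK.
(* The total mass is already 1; normalising supplies the structure of a probability. *)
pose P : probability R R := mnormalize m P1.
have PE D : P D = m D.
  rewrite -[P D]/((if (m setT == 0) || (m setT == +oo) then fun U => P1 U
    else fun U => m U * (fine (m setT))^-1%:E) D)%E.
  by rewrite m1 onee_eq0 /= invr1 mule1.
exists P; split => [D _|f mf f0]; first by rewrite PE mE.
have -> : (P : set R -> \bar R) = m by apply/funext => D; rewrite PE.
by rewrite ge0_integral_measure_add// !ge0_integral_mscale.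
Qed.

(** The pushforward agrees with Lebesgue measure on half-open intervals, and uniqueness does the
    rest. *)
Lemma lebesgue_measure_translate (R : realType) (v : R) (D : set R) :
  measurable D ->
  @lebesgue_measure R [set x | D (x + v)] = @lebesgue_measure R D.
Proof.
move=> mD; apply/esym.
have mt : measurable_fun [set: measurableTypeR R]
    (fun x : measurableTypeR R => (x + v : measurableTypeR R)).
  exact: measurable_funD.
pose t : {mfun measurableTypeR R >-> measurableTypeR R} :=
  HB.pack (fun x : measurableTypeR R => (x + v : measurableTypeR R))
    (isMeasurableFun.Build _ _ _ _ _ mt).
apply: (@lebesgue_measure_unique R (pushforward lebesgue_measure t)) => // X /ocitvP[->|[[a b] /= ab ->]].
  by rewrite !measure0.
rewrite /pushforward.
have -> : t @^-1` `]a, b]%classic = `]a - v, b - v]%classic.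
  by apply/seteqP; split => x /=; rewrite !in_itv /= lerBrDr ltrBlDr.
rewrite !lebesgue_measure_itv /= !lte_fin ltrD2r ab -!EFinB; congr EFin; lra.
Qed.

Lemma lebesgue_integral_translate (R : realType) (v : R) (f : R -> \bar R) :
  measurable_fun [set: R] f -> (forall x, 0 <= f x)%E ->
  (\int[@lebesgue_measure R]_x f (x + v)%R = \int[@lebesgue_measure R]_x f x)%E.
Proof.
move=> mf f0.
have mt : measurable_fun [set: measurableTypeR R]
    (fun x : measurableTypeR R => (x + v : measurableTypeR R)).
  exact: measurable_funD.
rewrite -[LHS](@ge0_integral_pushforward _ _ _ _ R _ mt lebesgue_measure setT f) //.
by apply: eq_measure_integral => A mA _; exact: lebesgue_measure_translate.
Qed.

(** * Noise distributions on the real line *)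

Section density_measure.
Context {R : realType}.
Local Open Scope ereal_scope.
Local Notation leb := (@lebesgue_measure R).
Variables (h : R -> R) (mh : measurable_fun [set: R] h).
Hypothesis h0 : forall x, (0 <= h x)%R.

(** Measurability and sign of the density are carried as arguments, so that the measure structure
    can be inferred from the term. *)
Definition density_measure of measurable_fun [set: R] h &
    (forall x, (0 <= h x)%R) :=
  fun D : set R => \int[leb]_(x in D) (h x)%:E.

Local Notation dens := (density_measure mh h0).

Let dens0 : dens set0 = 0.
Proof. by rewrite /density_measure integral_set0. Qed.

Let dens_ge0 D : 0 <= dens D.
Proof. by apply: integral_ge0 => x _; rewrite lee_fin. Qed.

Let mEh : measurable_fun [set: R] (fun x => (h x)%:E).
Proof. exact/measurable_EFinP. Qed.

Let dens_sigma_additive : semi_sigma_additive dens.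
Proof.
move=> F mF tF mUF; rewrite /density_measure; apply: cvg_toP.
  apply: ereal_nondecreasing_is_cvgn => m n mn.
  apply: lee_sum_nneg_natr => // k _ _; apply: integral_ge0 => x _.
  by rewrite lee_fin.
rewrite ge0_integral_bigcup//=.
- exact: measurable_funTS.
- by move=> x _; rewrite lee_fin.
Qed.

HB.instance Definition _ := isMeasure.Build _ _ _ dens
  dens0 dens_ge0 dens_sigma_additive.

Import HBNNSimple.

Let integral_dens_nnsfun (f : {nnsfun R >-> R}) :
  \int[dens]_x (f x)%:E = \int[leb]_x ((h x)%:E * (f x)%:E).
Proof.
have mI r : measurable_fun [set: R] (fun x => (r * \1_(f @^-1` [set r]) x)%:E).
  exact/measurable_EFinP/measurableT_comp.
have mI1 r : measurable_fun [set: R] (fun x => (\1_(f @^-1` [set r]) x : R)%:E).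
  exact/measurable_EFinP.
have hI0 r x : 0 <= (h x)%:E * (r * \1_(f @^-1` [set r]) x)%:E.
  by apply: mule_ge0; [rewrite lee_fin|rewrite EFinM nnfun_muleindic_ge0].
under [LHS]eq_integral do rewrite fimfunE -fsumEFin//.
rewrite [LHS]ge0_integral_fsum//; last first.
  by move=> n x _; rewrite EFinM nnfun_muleindic_ge0.
under [RHS]eq_integral.
  move=> x xD; rewrite fimfunE -fsumEFin// ge0_mule_fsumr; last first.
    by move=> r; rewrite EFinM nnfun_muleindic_ge0.
  over.
rewrite [RHS]ge0_integral_fsum//; last first.
  by move=> r; apply: emeasurable_funM; [exact: mEh|exact: mI].
apply: eq_fsbigr => r /set_mem [t _ ft].
have r0 : (0 <= r)%R by rewrite -ft.
under [RHS]eq_integral do rewrite EFinM muleCA.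
rewrite integralZl_indic_nnsfun//= integral_indic// setIT /density_measure.
rewrite ge0_integralZl//.
- congr (_ * _); rewrite [LHS]integral_mkcond; apply: eq_integral => x _.
  rewrite patchE indicE; case: ifPn => _; first by rewrite mule1.
  by rewrite mule0.
- by apply: emeasurable_funM; [exact: mEh|exact: mI1].
- by move=> x _; rewrite mule_ge0// lee_fin.
Qed.

Lemma ge0_integral_density (f : R -> \bar R) :
  measurable_fun [set: R] f -> (forall x, 0 <= f x) ->
  \int[dens]_x f x = \int[leb]_x ((h x)%:E * f x).
Proof.
move=> mf f0; pose f_ := nnsfun_approx measurableT mf.
have mf_ n : measurable_fun [set: R] (fun x => (f_ n x)%:E).
  exact/measurable_EFinP/measurable_funTS.
have nd_f x a b : (a <= b)%N -> (f_ a x <= f_ b x)%R.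
  by move=> ab; exact/lefP/nd_nnsfun_approx.
transitivity (limn (fun n => \int[dens]_x (f_ n x)%:E)).
  rewrite -monotone_convergence//=.
  - by apply: eq_integral => x _; apply/esym/cvg_lim => //; exact: cvg_nnsfun_approx.
  - by move=> n x _; rewrite lee_fin.
  - by move=> x _ a b ab; rewrite lee_fin; exact: nd_f.
under eq_fun do rewrite integral_dens_nnsfun.
rewrite -monotone_convergence//=.
- apply: eq_integral => x _; apply/cvg_lim => //; apply: cvgeZl => //.
  exact: cvg_nnsfun_approx.
- by move=> n; apply: emeasurable_funM; [exact: mEh|exact: mf_].
- by move=> n x _; rewrite mule_ge0// lee_fin.
- move=> x _ a b ab; apply: lee_wpmul2l; rewrite lee_fin//.
  exact: nd_f.
Qed.

End density_measure.

(** Privacy against one fixed shift with a free constant, so that the prices of several coordinates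
    can differ and be multiplied. *)
Definition shift_ratio (R : realType) (P : probability R R) (v K : R) : Prop :=
  forall D : set R, measurable D -> (P [set x | D (x + v)%R] <= K%:E * P D)%E.

Lemma finite_varianceP (R : realType) (P : probability R R) :
  finite_variance P <-> (\int[P]_x (x ^+ 2)%:E < +oo)%E.
Proof.
have abs2 : (\int[P]_x `|(x ^+ 2)%:E| = \int[P]_x (x ^+ 2)%:E)%E.
  by apply: eq_integral => x _; rewrite gee0_abs ?lee_fin ?sqr_ge0.
split=> [/integrableP[_]|fin]; first by rewrite abs2.
by apply/integrableP; split; [exact/measurable_EFinP/measurable_funX|rewrite abs2].
Qed.

Lemma measurable_translate (R : realType) (v : R) (D : set R) :
  measurable D -> measurable [set x | D (x + v)].
Proof.
move=> mD; rewrite -[X in measurable X]setTI.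
by apply: (_ : measurable_fun [set: R] (fun x => x + v)) => //; exact: measurable_funD.
Qed.

Lemma measurable_symitv (R : realType) (r : R) :
  measurable [set x : R | - r <= x <= r].
Proof.
have <- : `[- r, r]%classic = [set x | - r <= x <= r].
  by apply/seteqP; split => x /=; rewrite in_itv.
exact: measurable_itv.
Qed.

(** A density proportional to $(1+x^2)^{-2}$ serves. Multiplied by $x^2$ it stays below the
    integrable $(1+x^2)^{-1}$. Since $1+(x+v)^2\le(1+|v|)^2(1+x^2)$, a shift by $v$ costs at most
    $(1+|v|)^4\le e^{4|v|}$. *)
Lemma heavy_tailed_probability (R : realType) :
  exists P : probability R R,
    [/\ finite_variance P,
        forall v, shift_ratio P v (expR (4 * `|v|)) &
        forall r : R, 0 < r -> (0 < P [set x | - r <= x <= r]%R)%E].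
Proof.
pose h (x : R) := ((oneDsqr x) ^+ 2)^-1.
have d0 (x : R) : 0 < oneDsqr x by rewrite (lt_le_trans ltr01) ?oneDsqr_ge1.
have h0 x : 0 <= h x by rewrite invr_ge0 sqr_ge0.
have ch : continuous h.
  move=> x; apply: cvgV; first by rewrite sqrf_eq0 gt_eqF.
  by apply: cvgM; exact: continuous_oneDsqr.
have mh : measurable_fun [set: R] h by exact: continuous_measurable_fun.
have mEh : measurable_fun [set: R] (fun x => (h x)%:E) by exact/measurable_EFinP.
have cV : continuous (fun x : R => (oneDsqr x)^-1) by exact: continuous_oneDsqrV.
have mEV : measurable_fun [set: R] (fun x => ((oneDsqr x)^-1)%:E).
  by apply/measurable_EFinP; apply: continuous_measurable_fun; exact: cV.
have iV : (\int[@lebesgue_measure R]_x ((oneDsqr x)^-1)%:E < +oo)%E.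
  have V0 (x : R) : 0 <= (oneDsqr x)^-1 by rewrite invr_ge0 ltW.
  have Ve : (fun x : R => (oneDsqr x)^-1) =1 (fun x => (oneDsqr x)^-1) \o -%R.
    by move=> x/=; rewrite /oneDsqr sqrrN.
  have /= -> := ge0_symfun_integralT V0 cV Ve.
  rewrite (_ : [set x : R | _] = `[0, +oo[%classic); last first.
    by apply/seteqP; split => x/=; rewrite in_itv/= andbT.
  by rewrite integral0y_oneDsqr -EFinM ltry.
pose m := density_measure mh h0.
have ler (f : R -> R) : measurable_fun [set: R] f -> (forall x, 0 <= f x <= (oneDsqr x)^-1) ->
    (\int[@lebesgue_measure R]_x (f x)%:E < +oo)%E.
  move=> mf fV; apply: le_lt_trans iV; apply: ge0_le_integral => //.
  - by move=> x _; rewrite lee_fin; case/andP: (fV x).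
  - exact/measurable_EFinP.
  - by move=> x _; rewrite lee_fin; case/andP: (fV x).
have mT_fin : (m setT < +oo)%E.
  apply: ler => // x; rewrite h0 /= /h expr2 invfM; apply: ler_piMl.
    by rewrite invr_ge0 ltW.
  exact: oneDsqrV_le1.
have m_itv (r : R) : 0 < r -> (0 < m [set x | - r <= x <= r]%R)%E.
  have <- : `[- r, r]%classic = [set x | - r <= x <= r].
    by apply/seteqP; split => x /=; rewrite in_itv.
  move=> r0; pose A : set R := `[- r, r]%classic.
  have mA : measurable A by exact: measurable_itv.
  have hr : (\int[@lebesgue_measure R]_(x in A) (cst (h r)%:E x) <= m A)%E.
    apply: ge0_le_integral => //.
    - by move=> x _; rewrite /= lee_fin.
    - exact: (measurable_funTS mEh).
    - move=> x; rewrite /A /= in_itv/= => /andP[xr rx]; rewrite lee_fin /h.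
      rewrite lef_pV2 ?posrE ?exprn_gt0 ?d0// lerXn2r ?nnegrE ?(ltW (d0 _))//.
      have : 0 <= (r - x) * (r + x) by apply: mulr_ge0; lra.
      by rewrite /oneDsqr; nra.
  apply: lt_le_trans hr.
  rewrite integral_cst//= lebesgue_measure_itv/= lte_fin gtrN// -EFinB -EFinM lte_fin.
  by rewrite mulr_gt0 ?invr_gt0 ?exprn_gt0 ?d0// opprK addr_gt0.
have mT_gt0 : (0 < m setT)%E.
  apply: lt_le_trans (m_itv 1 ltr01) _; apply: le_measure; rewrite ?inE//.
  exact: measurable_symitv.
pose c := (fine (m setT))^-1.
have c0 : 0 < c by rewrite invr_gt0 fine_gt0// mT_gt0.
pose P : probability R R := mnormalize m (dirac (0 : R)).
have PE : (P : set R -> \bar R) = mscale (NngNum (ltW c0)) m.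
  apply/funext => D.
  rewrite -[P D]/((if (m setT == 0) || (m setT == +oo) then fun U => dirac (0%R : R) U
    else fun U => m U * (fine (m setT))^-1%:E) D)%E.
  by rewrite gt_eqF// lt_eqF//= muleC.
exists P; split.
- apply/finite_varianceP.
  have mx2 : measurable_fun [set: R] (fun x : R => (x ^+ 2)%:E).
    exact/measurable_EFinP/measurable_funX.
  have x2 (x : R) : (0 <= (x ^+ 2)%:E)%E by rewrite lee_fin sqr_ge0.
  rewrite (eq_measure_integral (mscale (NngNum (ltW c0)) m)); last first.
    by move=> A _ _; exact: (congr1 (fun F => F A) PE).
  rewrite ge0_integral_mscale// lte_mul_pinfty//.
  rewrite ge0_integral_density//.
  under eq_integral do rewrite -EFinM.
  apply: ler; first exact/measurable_funM/measurable_funX.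
  move=> x; rewrite mulr_ge0 ?sqr_ge0//= /h expr2 invfM -mulrA; apply: ler_piMr.
    by rewrite invr_ge0 ltW.
  by rewrite ler_pdivrMl// mulr1 lerDr.
- move=> v D mD.
  suff le_m : (m [set x | D (x + v)%R] <= (expR (4 * `|v|))%:E * m D)%E.
    by rewrite PE /mscale muleCA; apply: lee_wpmul2l.
  have ind (A : set R) : m A = (\int[@lebesgue_measure R]_x ((h x)%:E * (\1_A x)%:E))%E.
    rewrite -[m A]/(\int[@lebesgue_measure R]_(x in A) _)%E [LHS]integral_mkcond.
    apply: eq_integral => x _; rewrite patchE indicE.
    by case: ifPn => _; rewrite ?mule1 ?mule0.
  have mI (A : set R) : measurable A ->
      measurable_fun [set: R] (fun x => (\1_A x : R)%:E).
    by move=> mA; exact/measurable_EFinP.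
  have mhD : measurable_fun [set: R] (fun x : R => ((h x)%:E * (\1_D x : R)%:E)%E).
    by apply: emeasurable_funM; [exact: mEh|exact: mI].
  rewrite !ind.
  rewrite -(@lebesgue_integral_translate R v (fun x => (h x)%:E * (\1_D x)%:E)%E) //; last first.
    by move=> x; apply: mule_ge0; rewrite lee_fin.
  have mt : measurable_fun [set: R] (fun x : R => x + v) by exact: measurable_funD.
  have mht : measurable_fun [set: R] (fun x : R => ((h (x + v))%:E * (\1_D (x + v) : R)%:E)%E).
    exact: (measurableT_comp mhD mt).
  rewrite -ge0_integralZl//; last first.
    by move=> x _; apply: mule_ge0; rewrite lee_fin.
  apply: ge0_le_integral => //.
  - by move=> x _; apply: mule_ge0; rewrite lee_fin.
  - apply: emeasurable_funM; first exact: mEh.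
    by apply: mI; exact: measurable_translate.
  - by apply: emeasurable_funM => //; exact: measurable_cst.
  - move=> x _; rewrite muleA.
    have -> : \1_[set x | D (x + v)] x = \1_D (x + v) :> R by [].
    apply: lee_wpmul2r; rewrite ?lee_fin//.
    have e1 : 1 + `|v| <= expR `|v| by exact: expR_ge1Dx.
    have dv : oneDsqr (x + v) <= expR (2 * `|v|) * oneDsqr x.
      apply: (@le_trans _ _ ((1 + `|v|) ^+ 2 * oneDsqr x)).
        rewrite /oneDsqr; have := ler_norm (x * v); rewrite normrM.
        have := real_normK (num_real v); have := real_normK (num_real x).
        have := normr_ge0 v; have := normr_ge0 x.
        move: `|x| `|v| => X V X0 V0 X2 V2 XV.
        have : 0 <= V * (X - 1) ^+ 2 by rewrite mulr_ge0 ?sqr_ge0.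
        have : 0 <= V * V * X ^+ 2 by rewrite !mulr_ge0.
        have : 0 <= V * X ^+ 2 by rewrite !mulr_ge0 ?sqr_ge0.
        rewrite (sqrrD x v) -X2 -V2; nra.
      rewrite ler_pM2r ?d0// mulr_natl mulr2n expRD expr2.
      by apply: ler_pM; rewrite ?addr_ge0.
    rewrite /h ler_pdivlMr ?exprn_gt0 ?d0// mulrC ler_pdivrMr ?exprn_gt0 ?d0//.
    rewrite (_ : 4 * `|v| = 2 * `|v| + 2 * `|v|); last by ring.
    rewrite expRD -expr2 -exprMn lerXn2r ?nnegrE ?(ltW (d0 _))//.
- move=> r r0; rewrite PE /mscale mule_gt0//.
  exact: m_itv.
Qed.

(** * Product measures *)

Lemma xsectionE (T1 T2 : Type) (A : set (T1 * T2)) x :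
  xsection A x = [set y | A (x, y)].
Proof. by apply/seteqP; split => y /=; rewrite /xsection /= inE. Qed.

Lemma ysectionE (T1 T2 : Type) (A : set (T1 * T2)) y :
  ysection A y = [set x | A (x, y)].
Proof. by apply/seteqP; split => x /=; rewrite /ysection /= inE. Qed.

Lemma product_measure_sections (R : realType) d1 d2 (T1 : measurableType d1)
    (T2 : measurableType d2) (P1 : probability T1 R) (P2 : probability T2 R)
    (A : set (T1 * T2)) :
  measurable A ->
  ((P1 \x P2) A = \int[P1]_x P2 [set y | A (x, y)] /\
   (P1 \x P2) A = \int[P2]_y P1 [set x | A (x, y)])%E.
Proof.
move=> mA.
have E1 : ((P1 \x P2) A = \int[P1]_x P2 [set y | A (x, y)])%E.
  by rewrite /product_measure1; apply: eq_integral => x _ /=; rewrite xsectionE.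
split=> //; rewrite E1.
have := @indic_fubini_tonelli _ _ _ _ R P1 P2 A mA.
rewrite indic_fubini_tonelli_FE// indic_fubini_tonelli_GE// => E12.
transitivity (\int[P1]_x (P2 \o xsection A) x)%E.
  by apply: eq_integral => x _ /=; rewrite xsectionE.
by rewrite E12; apply: eq_integral => y _ /=; rewrite ysectionE.
Qed.

(** One coordinate moves at a time, through the event [A (f1 z.1, z.2)]: sections at fixed first
    coordinate give the factor [K2], sections at fixed second coordinate the factor [K1]. *)
Lemma product_measure_quasi_invariant (R : realType) d1 d2
    (T1 : measurableType d1) (T2 : measurableType d2)
    (P1 : probability T1 R) (P2 : probability T2 R)
    (f1 : T1 -> T1) (f2 : T2 -> T2) (K1 K2 : R) :
  measurable_fun [set: T1] f1 -> measurable_fun [set: T2] f2 ->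
  0 <= K1 -> 0 <= K2 ->
  (forall A, measurable A -> P1 (f1 @^-1` A) <= K1%:E * P1 A)%E ->
  (forall A, measurable A -> P2 (f2 @^-1` A) <= K2%:E * P2 A)%E ->
  forall A, measurable A ->
    ((P1 \x P2) [set z | A (f1 z.1, f2 z.2)] <= (K1 * K2)%:E * (P1 \x P2) A)%E.
Proof.
move=> mf1 mf2 K10 K20 le1 le2 A mA.
have preim d (T : measurableType d) d' (T' : measurableType d') (f : T -> T') B :
    measurable_fun [set: T] f -> measurable B -> measurable (f @^-1` B).
  by move=> mf mB; rewrite -[X in measurable X]setTI; exact: mf.
have mA1 : measurable [set z : T1 * T2 | A (f1 z.1, z.2)].
  apply: (preim _ _ _ _ (fun z : T1 * T2 => (f1 z.1, z.2))) => //.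
  by apply/measurable_fun_pair => //=; exact: measurableT_comp.
have mA2 : measurable [set z : T1 * T2 | A (f1 z.1, f2 z.2)].
  apply: (preim _ _ _ _ (fun z : T1 * T2 => (f1 z.1, f2 z.2))) => //.
  by apply/measurable_fun_pair => /=; exact: measurableT_comp.
have sec1 (B : set (T1 * T2)) x : measurable B -> measurable [set y | B (x, y)].
  by move=> mB; rewrite -xsectionE; exact: measurable_xsection.
have sec2 (B : set (T1 * T2)) y : measurable B -> measurable [set x | B (x, y)].
  by move=> mB; rewrite -ysectionE; exact: measurable_ysection.
have mF1 (B : set (T1 * T2)) : measurable B ->
    measurable_fun [set: T1] (fun x => P2 [set y | B (x, y)]).
  move=> mB; have := measurable_fun_xsection P2 mB; apply: eq_measurable_fun => x _ /=.
  by rewrite xsectionE.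
have mF2 (B : set (T1 * T2)) : measurable B ->
    measurable_fun [set: T2] (fun y => P1 [set x | B (x, y)]).
  move=> mB; have := measurable_fun_ysection P1 mB; apply: eq_measurable_fun => x _ /=.
  by rewrite ysectionE.
have [-> _] := product_measure_sections P1 P2 mA2.
apply: (@le_trans _ _ (K2%:E * (P1 \x P2) [set z | A (f1 z.1, z.2)])%E).
  have [-> _] := product_measure_sections P1 P2 mA1.
  rewrite -ge0_integralZl//; last exact: mF1.
  apply: ge0_le_integral => //; first exact: mF1.
    by apply: emeasurable_funM; [exact: measurable_cst|exact: mF1].
  by move=> x _; apply: le2; exact: (sec1 _ (f1 x)).
rewrite mulrC EFinM -muleA; apply: lee_wpmul2l; first by rewrite lee_fin.
have [_ ->] := product_measure_sections P1 P2 mA1.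
have [_ ->] := product_measure_sections P1 P2 mA.
rewrite -ge0_integralZl//; last exact: mF2.
apply: ge0_le_integral => //; first exact: mF2.
  by apply: emeasurable_funM; [exact: measurable_cst|exact: mF2].
by move=> y _; apply: le1; exact: sec2.
Qed.

(** * Second moments, centring and scaling *)

Lemma quadratic_integral (R : realType) d (T : measurableType d)
    (P : probability T R) (X : T -> R) :
  measurable_fun [set: T] X ->
  P.-integrable setT (fun w => (X w ^+ 2)%:E) ->
  P.-integrable setT (fun w => (X w)%:E) /\
  forall a b c : R,
    (\int[P]_w (a * X w ^+ 2 + b * X w + c)%:E =
     (a * fine (\int[P]_w (X w ^+ 2)%:E) + b * fine (\int[P]_w (X w)%:E) + c)%:E)%E.
Proof.
move=> mX iX2.
have i1 (c : R) : P.-integrable setT (fun=> c%:E).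
  exact: finite_measure_integrable_cst.
have iX : P.-integrable setT (fun w => (X w)%:E).
  have := integrableD measurableT iX2 (i1 1).
  apply: le_integrable => //; first exact/measurable_EFinP.
  move=> x _ /=; rewrite lee_fin [leRHS]ger0_norm ?addr_ge0 ?sqr_ge0//.
  have := sqr_ge0 (`|X x| - 1); rewrite -[X in _ <= X + _]real_normK ?num_real//.
  by have := normr_ge0 (X x); nra.
split=> // a b c.
have iaX2 : P.-integrable setT (fun w => a%:E * (X w ^+ 2)%:E)%E.
  exact: integrableZl.
have ibX : P.-integrable setT (fun w => b%:E * (X w)%:E)%E.
  exact: integrableZl.
under eq_integral do rewrite !EFinD !EFinM.
rewrite integralD//; last exact: integrableD.
rewrite integralD// !integralZl// integral_cst//= probability_setT mule1.
by rewrite !EFinD !EFinM !fineK ?integrable_fin_num.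
Qed.

(** Centring turns the variance into a second moment; as translations commute, it preserves all
    shift ratios. *)
Lemma centered_probability (R : realType) (P : probability R R) :
  finite_variance P ->
  exists P' : probability R R,
    [/\ finite_variance P', (\int[P']_x x%:E = 0)%E,
        (\int[P']_x (x ^+ 2)%:E = (variance_of P)%:E)%E &
        forall v K, shift_ratio P v K -> shift_ratio P' v K].
Proof.
move=> fP; have mid : measurable_fun [set: R] (fun x : R => x) by exact: measurable_id.
have [iX quad] := quadratic_integral mid fP.
pose m := fine (\int[P]_x x%:E)%E.
have mX : measurable_fun [set: R] (fun x : R => x - m).
  exact: measurable_funB.
have [P' P'E] := pushforward_probability P mX.
have mx2 : measurable_fun [set: R] (fun x : R => (x ^+ 2)%:E).
  exact/measurable_EFinP/measurable_funX.
have P'_int f : measurable_fun [set: R] f -> (forall x, 0 <= f x)%E ->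
    (\int[P']_x f x = \int[P]_x f (x - m)%R)%E.
  move=> mf f0; rewrite (eq_measure_integral (pushforward P (fun x : R => x - m))).
    by rewrite ge0_integral_pushforward.
  by move=> A _ _; exact: (congr1 (fun F => F A) P'E).
have E2 : (\int[P']_x (x ^+ 2)%:E = (variance_of P)%:E)%E.
  rewrite P'_int//; last by move=> x; rewrite lee_fin sqr_ge0.
  transitivity (\int[P]_x (1 * x ^+ 2 + (- (2 * m)) * x + m ^+ 2)%:E)%E.
    by apply: eq_integral => x _; congr EFin; ring.
  rewrite quad -/m /variance_of -/m; congr EFin; ring.
have fP' : finite_variance P'.
  by apply/finite_varianceP; rewrite E2 ltry.
exists P'; split => //.
- rewrite (eq_measure_integral (pushforward P (fun x : R => x - m))); last first.
    by move=> A _ _; exact: (congr1 (fun F => F A) P'E).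
  have iXm : P.-integrable setT (fun x : R => (x - m)%:E).
    under eq_fun do rewrite EFinB.
    by apply: integrableB => //; exact: finite_measure_integrable_cst.
  rewrite integral_pushforward//.
  transitivity (\int[P]_x (0 * x ^+ 2 + 1 * x + (- m))%:E)%E.
    by apply: eq_integral => x _ /=; congr EFin; ring.
  by rewrite quad -/m; congr EFin; ring.
- move=> v K PK D mD; rewrite P'E /pushforward.
  have := PK _ (measurable_translate (- m) mD).
  congr (_ <= _)%E; congr (P _); apply/seteqP; split => x /=;
    by rewrite addrAC.
Qed.

(** Stretching by $c=4/\kappa$ divides shifts by $c$, so a shift of length at most 1 costs at most
    $e^{4/c}=e^{\kappa}$. *)
Lemma scaled_heavy_tailed_probability (R : realType) (kappa : R) : 0 < kappa ->
  exists P : probability R R,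
    [/\ finite_variance P,
        forall v : R, `|v| <= 1 -> shift_ratio P v (expR kappa) &
        forall r : R, 0 < r -> (0 < P [set x | - r <= x <= r]%R)%E].
Proof.
move=> k0; have [P [fP Psh Ppos]] := heavy_tailed_probability R.
pose c := 4 / kappa; have c0 : 0 < c by rewrite divr_gt0.
have mX : measurable_fun [set: R] (fun x : R => c * x) by exact: measurable_funM.
have [P' P'E] := pushforward_probability P mX.
have mx2 : measurable_fun [set: R] (fun x : R => (x ^+ 2)%:E).
  exact/measurable_EFinP/measurable_funX.
have mid : measurable_fun [set: R] (fun x : R => x) by exact: measurable_id.
have [iX quad] := quadratic_integral mid fP.
exists P'; split.
- apply/finite_varianceP; rewrite (eq_measure_integral (pushforward P (fun x : R => c * x))); last first.
    by move=> A _ _; exact: (congr1 (fun F => F A) P'E).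
  rewrite ge0_integral_pushforward//; last by move=> x _; rewrite lee_fin sqr_ge0.
  rewrite (_ : integral _ _ _ =
      \int[P]_x (c ^+ 2 * x ^+ 2 + 0 * x + 0)%:E)%E; first by rewrite quad ltry.
  by apply: eq_integral => x _ /=; congr EFin; ring.
- move=> v v1 D mD; rewrite P'E /pushforward.
  have mcD : measurable [set x | D (c * x)].
    by rewrite -[X in measurable X]setTI; exact: mX.
  have := Psh (v / c) _ mcD.
  rewrite (_ : [set x | [set x | D (c * x)] (x + v / c)] =
    (fun x : R => c * x) @^-1` [set x | D (x + v)]); last first.
    by apply/seteqP; split => x /=; rewrite mulrDr mulrCA divff ?mulr1// gt_eqF.
  move=> /le_trans; apply; apply: lee_wpmul2r => //; rewrite lee_fin ler_expR.
  rewrite normrM normfV (gtr0_norm c0) mulrA ler_pdivrMr// /c mulrCA divff ?gt_eqF//.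
  by rewrite mulr1 ler_piMr.
- move=> r r0; rewrite P'E /pushforward.
  rewrite (_ : _ @^-1` _ = [set x | - (r / c) <= x <= r / c]); last first.
    apply/funext => x /=; congr is_true.
    by rewrite -mulNr ler_pdivrMr// ler_pdivlMr// (mulrC x).
  by apply: Ppos; rewrite divr_gt0.
Qed.

(** * Interpolation *)

(** The weight of a node of [S] is the coefficient of degree [k0] of its Lagrange basis polynomial.
    Interpolation on [S] reproduces $X^k$ for $k\le T<|S|$; comparing coefficients of degree [k0]
    gives the sums. *)
Lemma interpolation_weights (F : fieldType) (alpha : nat -> F) (N T : nat)
    (S : {set 'I_N}) (k0 : nat) :
  injective alpha -> (T < #|S|)%N ->
  exists w : 'I_N -> F,
    (forall i, i \notin S -> w i = 0) /\
    forall k, (k <= T)%N -> \sum_i w i * alpha i ^+ k = (k == k0)%:R.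
Proof.
move=> inj_a TS.
pose s := [seq val i | i <- enum S].
have size_s : size s = #|S| by rewrite size_map -cardE.
have s_ltN (d j : nat) : (j < #|S|)%N -> (nth d s j < N)%N.
  rewrite -size_s => js; have /mapP[i _ ->] := mem_nth d js.
  exact: ltn_ord.
have uniq_s : uniq s by rewrite map_inj_uniq ?enum_uniq//; exact: val_inj.
(* The Lagrange basis of the library requires nodes indexed by all of nat. *)
pose x (j : nat) := alpha (nth (N + j) s j).
have inj_x : injective x.
  move=> i j /inj_a.
  have [iS|iS] := ltnP i #|S|; have [jS|jS] := ltnP j #|S|.
  - rewrite (set_nth_default (N + i)) ?size_s// => /eqP.
    by rewrite nth_uniq ?size_s// => /eqP.
  - rewrite [in RHS]nth_default ?size_s// => ij.
    by have := s_ltN (N + i)%N i iS; rewrite ij ltnNge leq_addr.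
  - rewrite [in LHS]nth_default ?size_s// => ij.
    by have := s_ltN (N + j)%N j jS; rewrite -ij ltnNge leq_addr.
  - by rewrite !nth_default ?size_s// => /addnI.
have S0 : (0 < #|S|)%N by exact: leq_ltn_trans TS.
pose l (j : 'I_#|S|) : {poly F} := tnth (lagrange #|S| x) j.
pose w (i : 'I_N) := \sum_(j < #|S| | enum_val j == i) (l j)`_k0.
exists w; split=> [i iS|k kT].
  apply: big1 => j /eqP ij; move: iS; rewrite -ij; case/negP; exact: enum_valP.
under eq_bigr do rewrite big_distrl /=.
rewrite (exchange_big_dep xpredT)//=.
rewrite (eq_bigr (fun j => (l j)`_k0 * alpha (enum_val j) ^+ k)); last first.
  by move=> j _; rewrite (big_pred1 (enum_val j))// => i; rewrite /= eq_sym.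
have sX : (size ('X^k : {poly F}) <= #|S|)%N by rewrite size_polyXn (leq_ltn_trans kT).
have := congr1 (fun p : {poly F} => p`_k0) (lagrange_gen S0 inj_x sX).
rewrite coefXn eq_sym => ->; rewrite coef_sum; apply: eq_bigr => j _.
rewrite coefCM hornerXn mulrC; congr (_ ^+ k * _).
rewrite /x (nth_map (enum_val j)) -?cardE//; congr alpha; congr val.
exact: enum_val_nth.
Qed.

Lemma prod_Xadd_coef_ge0 (F : numDomainType) (I : finType) (c : I -> F) :
  (forall i, 0 <= c i) ->
  forall k, 0 <= (\prod_i ('X + (c i)%:P))`_k.
Proof.
move=> c0; apply: (big_ind (fun p : {poly F} => forall k, 0 <= p`_k)) => [k|p q p0 q0 k|i _ k].
- by rewrite coef1 ler0n.
- by rewrite coefM sumr_ge0// => i _; rewrite mulr_ge0.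
- by rewrite coefD coefX coefC addr_ge0//; case: ifP.
Qed.

(** The [q k] are the lower coefficients of the monic polynomial vanishing at the colluding nodes.
    As the nodes are negative, its coefficients are nonnegative, and each is bounded by the value of
    the polynomial at 1. *)
Lemma collusion_coefficients (F : numFieldType) (N T : nat) (t : 'I_T -> 'I_N) :
  exists q : 'I_T -> F,
    (forall k, 0 <= q k <= (N.+1 ^ T)%:R) /\
    forall j, - (- ((t j).+1)%:R) ^+ T = \sum_(k < T) q k * (- ((t j).+1)%:R) ^+ k.
Proof.
pose p : {poly F} := \prod_(j < T) ('X + ((t j).+1)%:R%:P).
have p0 k : 0 <= p`_k by apply: prod_Xadd_coef_ge0 => i.
have sp : size p = T.+1.
  rewrite /p (eq_bigr (fun j => 'X - (- ((t j).+1)%:R)%:P)); last first.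
    by move=> j _; rewrite polyCN opprK.
  by rewrite size_prod_XsubC /index_enum -enumT size_enum_ord.
have lp : p`_T = 1.
  have -> : T = (size p).-1 by rewrite sp.
  rewrite -/(lead_coef p) /p (eq_bigr (fun j => 'X - (- ((t j).+1)%:R)%:P)); last first.
    by move=> j _; rewrite polyCN opprK.
  by apply/eqP; apply: monic_prod_XsubC.
exists (fun k => p`_k); split=> [k|j].
  rewrite p0 /=.
  have p1 : p.[1] <= (N.+1 ^ T)%:R.
    rewrite horner_prod natrX -[in leRHS](card_ord T) -prodr_const.
    apply: ler_prod => i _; rewrite !hornerE /= addr_ge0//=.
    by rewrite -[1]/(1%:R : F) -natrD ler_nat add1n ltnS ltn_ord.
  apply: le_trans p1; rewrite (horner_coef_wide _ (_ : (size p <= T.+1)%N)) ?sp//.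
  rewrite (bigD1 (widen_ord (leqnSn T) k))//= expr1n mulr1 lerDl sumr_ge0// => i _.
  by rewrite expr1n mulr1.
have : p.[- ((t j).+1)%:R] = 0.
  by rewrite horner_prod (bigD1 j)//= !hornerE addNr mul0r.
rewrite (horner_coef_wide _ (_ : (size p <= T.+1)%N)) ?sp// big_ord_recr/= lp mul1r.
by move=> /eqP; rewrite addr_eq0 => /eqP ->.
Qed.

(** * Independent coordinates with prescribed laws *)

(** Independence is recorded in the form that privacy uses: shifting all coordinates at once is a
    map of the sample space, and its price is the product of the prices of the coordinates. The
    space is an iterated binary product, and the price follows by induction. *)
Lemma independent_coordinates (R : realType) (n : nat)
    (mu : 'I_n -> probability R R) :
  exists (d : measure_display) (Om : measurableType d) (Q : probability Om R)
         (Z : 'I_n -> Om -> R),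
    [/\ forall i, measurable_fun [set: Om] (Z i),
        forall i D, measurable D -> Q (Z i @^-1` D) = mu i D &
        forall v K : 'I_n -> R, (forall i, 0 <= K i) ->
          (forall i, shift_ratio (mu i) (v i) (K i)) ->
          exists sh : Om -> Om,
            [/\ measurable_fun [set: Om] sh,
                forall i w, Z i (sh w) = Z i w + v i &
                forall D, measurable D ->
                  (Q (sh @^-1` D) <= (\prod_i K i)%:E * Q D)%E]].
Proof.
elim: n mu => [|n IH] mu.
  exists _, R, (dirac (0 : R) : probability R R), (fun _ _ => 0).
  split; [by case|by case|move=> v K _ _].
  exists id; split; [exact: measurable_id|by case|move=> D mD].
  by rewrite big_ord0 mul1e.
have [d [Om [Q [Z [mZ lawZ shZ]]]]] := IH (fun i => mu (lift ord0 i)).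
pose Q' : probability (R * Om)%type R := (mu ord0 \x Q)%E.
pose Z' (i : 'I_n.+1) (w : R * Om) :=
  if unlift ord0 i is Some j then Z j w.2 else w.1.
have Z'0 w : Z' ord0 w = w.1 by rewrite /Z' unlift_none.
have Z'S j w : Z' (lift ord0 j) w = Z j w.2 by rewrite /Z' liftK.
exists _, (R * Om)%type, Q', Z'; split=> [i|i D mD|v K K0 muK].
- have [j ->|->] := unliftP ord0 i.
    rewrite (_ : Z' _ = Z j \o snd); last by apply/funext => w; rewrite Z'S.
    by apply: measurableT_comp => //; exact: measurable_snd.
  rewrite (_ : Z' _ = fst); last by apply/funext => w; rewrite Z'0.
  exact: measurable_fst.
- have [j ->|->] := unliftP ord0 i.
    rewrite (_ : Z' _ @^-1` D = setT `*` (Z j @^-1` D)); last first.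
      by apply/seteqP; split => w /=; rewrite Z'S => // -[].
    have mZD : measurable (Z j @^-1` D).
      by rewrite -[X in measurable X]setTI; exact: mZ.
    have -> : Q' (setT `*` (Z j @^-1` D)) =
        (mu ord0 setT * Q (Z j @^-1` D))%E by exact: product_measure1E.
    by rewrite probability_setT mul1e lawZ.
  rewrite (_ : Z' _ @^-1` D = D `*` setT); last first.
    by apply/seteqP; split => w /=; rewrite Z'0 => // -[].
  have -> : Q' (D `*` setT) = (mu ord0 D * Q setT)%E by exact: product_measure1E.
  by rewrite probability_setT mule1.
- have [sh [msh Zsh Qsh]] := shZ (fun j => v (lift ord0 j)) (fun j => K (lift ord0 j))
    (fun j => K0 _) (fun j => muK _).
  have mt : measurable_fun [set: R] (fun x : R => x + v ord0).
    exact: measurable_funD.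
  exists (fun w => (w.1 + v ord0, sh w.2)); split.
  + apply/measurable_fun_pair.
      exact: (measurableT_comp mt measurable_fst).
    exact: (measurableT_comp msh measurable_snd).
  + move=> i w; have [j ->|->] := unliftP ord0 i.
      by rewrite !Z'S Zsh.
    by rewrite !Z'0.
  + move=> D mD; rewrite big_ord_recl.
    apply: (product_measure_quasi_invariant mt msh) => //.
      by apply: prodr_ge0 => j _; exact: K0.
    by move=> A mA; exact: muK.
Qed.

(** * Nearly optimal noise with a strict privacy margin *)

Lemma noise_DP1P (R : realType) (eps : R) (P : probability R R) :
  noise_DP1 eps P <-> forall v, `|v| <= 1 -> shift_ratio P v (expR eps).
Proof.
split=> [DP v v1 D mD|sh x' x'' xx B mB].
  have := DP v 0 _ D mD; rewrite subr0 => /(_ v1).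
  congr (_ <= _ * _)%E; congr (P _); apply/seteqP; split => x /=;
    by rewrite ?add0r// addrC.
have mB' : measurable [set x | B (x'' + x)].
  by rewrite (_ : mkset _ = [set x | B (x + x'')]);
    [exact: measurable_translate|apply/seteqP; split => x /=; rewrite addrC].
have := sh _ xx _ mB'; congr (_ <= _)%E; congr (P _).
by apply/seteqP; split => x /=; congr B; ring.
Qed.

(** An infimum in [R] is approached only for a nonempty set bounded below: the scaled heavy-tailed
    law gives a member, and a variance is nonnegative as a centred second moment. *)
Lemma sigma_star_approx (R : realType) (eps delta : R) : 0 < eps -> 0 < delta ->
  0 <= sigma_star_sq eps /\
  exists P : probability R R,
    [/\ finite_variance P, noise_DP1 eps P &
        variance_of P <= sigma_star_sq eps + delta].
Proof.
move=> e0 d0; rewrite /sigma_star_sq; set E := (X in inf X).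
have E_ge0 : lbound E 0.
  move=> _ [P [fP _] <-].
  have [P' [_ _ E2 _]] := centered_probability fP.
  rewrite -lee_fin -E2; apply: integral_ge0 => x _.
  by rewrite lee_fin sqr_ge0.
have E_neq0 : E !=set0.
  have [P [fP Psh _]] := scaled_heavy_tailed_probability e0.
  by exists (variance_of P); exists P => //; split=> //; exact/noise_DP1P.
have infE : has_inf E by split=> //; exists 0.
split; first exact: lb_le_inf.
have [_ [P [fP DP] <-] /ltW leP] := inf_adherent d0 infE.
by exists P.
Qed.

(** Relative to the mixed mass $(1-p)m+pn$, the left side is a mean of [a] and [b] with most weight
    on the larger [a] when $m=Kn$. The weights [K] and [p] give a slightly larger mean, still below
    [a] when $b<a$. *)
Lemma ratio_interpolation (R : realFieldType) (a b K p m n : R) :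
  b <= a -> 0 < K -> 0 < p < 1 -> 0 <= m -> m <= K * n ->
  (1 - p) * (a * m) + p * (b * n) <=
  (K * a + p * b) / (K + p) * ((1 - p) * m + p * n).
Proof.
move=> ba K0 /andP[p0 p1] m0 mn.
have Kp : 0 < K + p by rewrite addr_gt0.
rewrite mulrAC ler_pdivlMr//.
have -> : (K * a + p * b) * ((1 - p) * m + p * n) =
  ((1 - p) * (a * m) + p * (b * n)) * (K + p) +
  (a - b) * p * (K * n - m + p * m) by ring.
rewrite lerDl !mulr_ge0// ?subr_ge0 ?(ltW p0)//.
by rewrite addr_ge0 ?mulr_ge0 ?subr_ge0 ?(ltW p0).
Qed.

(* The optimal noise P is mixed with a little of its convolution nu with a
   smoother noise L: nu dominates a multiple of P and has a smaller privacy
   loss, so the mixture satisfies the privacy inequality with room to spare. *)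
Lemma strict_noise (R : realType) (eps delta : R) : 0 < eps -> 0 < delta ->
  exists (P : probability R R) (theta : R),
    [/\ 0 < theta < expR eps, finite_variance P,
        (\int[P]_x x%:E = 0)%E,
        (\int[P]_x (x ^+ 2)%:E <= (sigma_star_sq eps + delta)%:E)%E &
        forall v, `|v| <= 1 -> shift_ratio P v theta].
Proof.
move=> e0 d0.
have h0 : 0 < delta / 2 by rewrite divr_gt0.
have [s0 [mu0 [fmu0 DPmu0 var_mu0]]] := sigma_star_approx e0 h0.
have [mu [fmu _ mu2 mush]] := centered_probability fmu0.
have {}DPmu v : `|v| <= 1 -> shift_ratio mu v (expR eps).
  by move=> v1; apply: mush; exact: (noise_DP1P eps mu0).1.
have e20 : 0 < eps / 2 by rewrite divr_gt0.
have [L [fL Lsh Lpos]] := scaled_heavy_tailed_probability e20.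
have x20 (x : R) : (0 <= (x ^+ 2)%:E)%E by rewrite lee_fin sqr_ge0.
have mx2 : measurable_fun [set: R] (fun x : R => (x ^+ 2)%:E).
  exact/measurable_EFinP/measurable_funX.
pose prod : probability (R * R)%type R := (mu \x L)%E.
have mD2 : measurable_fun [set: R * R] (fun z : R * R => z.1 + z.2).
  by apply: measurable_funD; [exact: measurable_fst|exact: measurable_snd].
have [nu nuE] := pushforward_probability prod mD2.
have msum (D : set R) : measurable D -> measurable [set z : R * R | D (z.1 + z.2)].
  by move=> mD; rewrite -[X in measurable X]setTI; exact: mD2.
have nush v : `|v| <= 1 -> shift_ratio nu v (expR (eps / 2)).
  move=> v1 D mD; rewrite nuE /pushforward.
  have mt : measurable_fun [set: R] (fun x : R => x + v) by exact: measurable_funD.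
  have := @product_measure_quasi_invariant R _ _ _ _ mu L id (fun x : R => x + v)
    1 (expR (eps / 2)) (@measurable_id _ _ _) mt ler01 (expR_ge0 _) _ (Lsh _ v1) _ (msum _ mD).
  rewrite mul1r => /(_ (fun A _ => _)).
  have le1 (A : set R) : (mu (id @^-1` A) <= 1%:E * mu A)%E by rewrite mul1e.
  move=> /(_ le1); congr (_ <= _)%E; congr (prod _).
  by apply/seteqP; split => z /=; rewrite addrA.
pose a := fine (L [set x : R | - 1 <= x <= 1]).
have aE : (a%:E = L [set x : R | (- 1 <= x <= 1)%R])%E.
  by rewrite fineK// fin_num_measure//; exact: measurable_symitv.
have a0 : 0 < a by rewrite -lte_fin aE Lpos.
(* Shifts by at most 1 cost [mu] the factor $e^\epsilon$, and [L] gives these shifts mass [a];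
   averaging over them bounds [mu] by [K] times the convolution. *)
pose K := expR eps / a; have K0 : 0 < K by rewrite divr_gt0 ?expR_gt0.
have mu_nu (D : set R) : measurable D -> (mu D <= K%:E * nu D)%E.
  move=> mD; suff : (mu D * a%:E <= (expR eps)%:E * nu D)%E.
    move=> le_mu; have -> : (mu D = a^-1%:E * (mu D * a%:E))%E.
      by rewrite muleCA -EFinM mulVf ?gt_eqF// mule1.
    rewrite /K (mulrC (expR eps)) EFinM -muleA.
    by apply: lee_wpmul2l; [rewrite lee_fin invr_ge0 ltW|exact: le_mu].
  have -> : nu D = (\int[L]_y mu [set x | D (x + y)%R])%E.
    rewrite nuE /pushforward.
    exact: (product_measure_sections mu L (msum _ mD)).2.
  have mF : measurable_fun [set: R] (fun y => mu [set x | D (x + y)]).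
    have := measurable_fun_ysection mu (msum _ mD).
    by apply: eq_measurable_fun => y _ /=; rewrite ysectionE.
  rewrite aE -integral_cst//; last exact: measurable_symitv.
  rewrite -ge0_integralZl//.
  apply: (@le_trans _ _ (\int[L]_(y in [set x : R | (- 1 <= x <= 1)%R])
      ((expR eps)%:E * mu [set x | D (x + y)%R]))%E).
    apply: ge0_le_integral => //; first exact: measurable_symitv.
      apply: measurable_funTS.
      by apply: emeasurable_funM; [exact: measurable_cst|exact: mF].
    move=> y /= y1; have ny : `|- y| <= 1 by rewrite normrN ler_norml.
    have := DPmu _ ny _ (measurable_translate y mD).
    by congr (mu _ <= _)%E; apply/seteqP; split => x /=; rewrite subrK.
  apply: ge0_subset_integral => //; first exact: measurable_symitv.
  - by apply: emeasurable_funM; [exact: measurable_cst|exact: mF].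
  - by move=> y _; rewrite mule_ge0// lee_fin expR_ge0.
have nu2 : (\int[nu]_x (x ^+ 2)%:E < +oo)%E.
  rewrite (eq_measure_integral (pushforward prod (fun z : R * R => z.1 + z.2))); last first.
    by move=> A _ _; exact: (congr1 (fun F => F A) nuE).
  rewrite ge0_integral_pushforward// preimage_setT.
  pose f1 (z : R * R) := (2 * z.1 ^+ 2)%:E.
  pose f2 (z : R * R) := (2 * z.2 ^+ 2)%:E.
  have mf1 : measurable_fun [set: R * R] f1.
    apply/measurable_EFinP/measurable_funM => //; apply: measurable_funX.
    exact: measurable_fst.
  have mf2 : measurable_fun [set: R * R] f2.
    apply/measurable_EFinP/measurable_funM => //; apply: measurable_funX.
    exact: measurable_snd.
  have f10 z : (0 <= f1 z)%E by rewrite lee_fin mulr_ge0 ?sqr_ge0.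
  have f20 z : (0 <= f2 z)%E by rewrite lee_fin mulr_ge0 ?sqr_ge0.
  have i2 (P : probability R R) : finite_variance P ->
      (\int[P]_x (2 * x ^+ 2)%:E < +oo)%E.
    move=> /finite_varianceP fP; under eq_integral do rewrite EFinM.
    by rewrite ge0_integralZl// lte_mul_pinfty.
  apply: (@le_lt_trans _ _ (\int[prod]_z (f1 z + f2 z))%E).
    apply: ge0_le_integral => //.
    - by move=> z _; rewrite /= lee_fin sqr_ge0.
    - exact: (measurableT_comp mx2 mD2).
    - exact: emeasurable_funD.
    - move=> z _; rewrite /= lee_fin.
      by have := sqr_ge0 (z.1 - z.2); nra.
  rewrite ge0_integralD// (fubini_tonelli1 _ mf1)// (fubini_tonelli1 _ mf2)//.
  rewrite /fubini_F /f1 /f2 /=; apply: lte_add_pinfty.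
    under eq_integral => x _ do rewrite integral_cst//= probability_setT mule1.
    exact: i2.
  by rewrite integral_cst//= probability_setT mule1; exact: i2.
pose C := fine (\int[nu]_x (x ^+ 2)%:E)%E.
have CE : (\int[nu]_x (x ^+ 2)%:E = C%:E)%E.
  by rewrite fineK// ge0_fin_numE//; exact: integral_ge0.
have C0 : 0 <= C by rewrite fine_ge0//; exact: integral_ge0.
(* Chosen so that [nu] adds at most [delta / 2] to the second moment; the summand 1 keeps [p] below
   1 even if [C] vanishes. *)
pose p := delta / 2 / (delta / 2 + C + 1).
have pd : 0 < delta / 2 + C + 1 by rewrite ltr_pwDr// addr_ge0// ltW.
have p01 : 0 < p < 1.
  by rewrite divr_gt0//= ltr_pdivrMr// mul1r; lra.
have p01' : 0 <= p <= 1 by case/andP: p01 => /ltW -> /ltW ->.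
have pC : p * C <= delta / 2.
  rewrite /p mulrAC ler_pdivrMr// ler_pM2l//; lra.
have [P [PE PintE]] := mixture_probability mu nu p01'.
pose theta := (K * expR eps + p * expR (eps / 2)) / (K + p).
have Psh v : `|v| <= 1 -> shift_ratio P v theta.
  move=> v1 D mD; rewrite !PE//; last exact: measurable_translate.
  have fin (Q : probability R R) (A : set R) : measurable A -> Q A = (fine (Q A))%:E.
    by move=> mA; rewrite fineK// fin_num_measure.
  have := DPmu _ v1 D mD; have := nush _ v1 D mD; have := mu_nu _ mD.
  have mDv := measurable_translate v mD.
  rewrite (fin mu _ mD) (fin nu _ mD) (fin mu _ mDv) (fin nu _ mDv).
  set m := fine (mu D); set m' := fine (mu _); set n := fine (nu D).
  set n' := fine (nu _) => mn nv muv.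
  have {}mn : m <= K * n by rewrite -lee_fin EFinM.
  have {}nv : n' <= expR (eps / 2) * n by rewrite -lee_fin EFinM.
  have {}muv : m' <= expR eps * m by rewrite -lee_fin EFinM.
  suff : (1 - p) * m' + p * n' <= theta * ((1 - p) * m + p * n).
    by rewrite -lee_fin EFinM !EFinD !EFinM.
  have ab : expR (eps / 2) <= expR eps by rewrite ler_expR; lra.
  have m0 : 0 <= m by rewrite fine_ge0.
  apply: le_trans (ratio_interpolation ab K0 p01 m0 mn).
  case/andP: p01' => p0 p1.
  by apply: lerD; apply: ler_wpM2l; rewrite ?subr_ge0.
have P2E : (\int[P]_x (x ^+ 2)%:E = ((1 - p) * variance_of mu0 + p * C)%:E)%E.
  by rewrite PintE// mu2 CE.
have fP : finite_variance P.
  by apply/finite_varianceP; rewrite P2E ltry.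
(* [nu] need not be centred, hence the mixture is centred again; this does not increase its second
   moment. *)
have [P' [fP' P'1 P'2 P'sh]] := centered_probability fP.
exists P', theta; split=> //.
- case/andP: p01 => p0 p1.
  have eh : expR (eps / 2) < expR eps by rewrite ltr_expR; lra.
  have := expR_gt0 (eps / 2); have := expR_gt0 eps => E1 E2.
  have Kp : 0 < K + p by rewrite addr_gt0.
  rewrite /theta; apply/andP; split.
    by rewrite divr_gt0// addr_gt0// mulr_gt0.
  by rewrite ltr_pdivrMr// mulrDr (mulrC K) ltrD2l mulrC ltr_pM2r.
- rewrite P'2 lee_fin /variance_of P2E /=.
  have v0 : 0 <= variance_of mu0.
    by rewrite -lee_fin -mu2; apply: integral_ge0.
  have := sqr_ge0 (fine (\int[P]_x x%:E)%E).
  move: var_mu0 pC v0; case/andP: p01' => p0 p1; nra.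
- by move=> v v1; apply: P'sh; exact: Psh.
Qed.

(** * Events on noise vectors and iterated integrals *)

(** The sets with measurable preimage form a sigma-algebra that contains the boxes generating
    [borel_vec]. *)
Lemma measurable_borel_vec (R : realType) d (Om : measurableType d) (n : nat)
    (F : 'I_n -> Om -> R) (B : set ('I_n -> R)) :
  (forall j, measurable_fun [set: Om] (F j)) -> borel_vec B ->
  measurable [set w | B (fun j => F j w)].
Proof.
move=> mF; apply: (_ : _ `<=` [set B | measurable [set w | B (fun j => F j w)]]).
apply: smallest_sub; first split => /=.
- exact: measurable0.
- move=> A mA; rewrite (_ : mkset _ = ~` [set w | A (fun j => F j w)]).
    exact: measurableC.
  by apply/seteqP; split => w /= => [[]|].
- move=> A mA; rewrite (_ : mkset _ = \bigcup_k [set w | A k (fun j => F j w)]).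
    exact: bigcup_measurable.
  by apply/seteqP; split => w /= [k _ Ak]; exists k.
move=> _ [Bs mBs <-] /=.
rewrite (_ : mkset _ = \bigcap_(j in [set: 'I_n]) (F j @^-1` Bs j)); last first.
  by apply/seteqP; split => w /= wB j => [_|]; exact: wB.
apply: fin_bigcap_measurable => // j _.
by rewrite -[X in measurable X]setTI; apply: mF => //; exact: mBs.
Qed.

(** An upper bound on the inner integral suffices, so variables can be removed one by one without
    computing any integral exactly. *)
Lemma le_fubini (R : realType) d1 (T1 : measurableType d1) d2
    (T2 : measurableType d2) (P : probability T1 R) (Q : probability T2 R)
    (f : T1 * T2 -> R) (g : T1 -> R) :
  measurable_fun [set: T1 * T2] f -> measurable_fun [set: T1] g ->
  (forall z, 0 <= f z) ->
  (forall x, \int[Q]_y (f (x, y))%:E <= (g x)%:E)%E ->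
  (\int[P \x Q]_z (f z)%:E <= \int[P]_x (g x)%:E)%E.
Proof.
move=> mf mg f0 fg.
have mEf : measurable_fun [set: T1 * T2] (fun z => (f z)%:E).
  exact/measurable_EFinP.
have Ef0 z : (0 <= (f z)%:E)%E by rewrite lee_fin.
rewrite (fubini_tonelli1 _ mEf Ef0).
have mF := @measurable_fun_fubini_tonelli_F _ _ _ _ R Q _ mEf Ef0.
apply: ge0_le_integral => //.
- by move=> x _; exact: integral_ge0.
- exact/measurable_EFinP.
- by move=> x _; exact: fg.
Qed.

Lemma le_integralZ (R : realType) d (T : measurableType d) (P : probability T R)
    (f : T -> R) (c b : R) :
  0 <= c -> measurable_fun [set: T] f -> (forall x, 0 <= f x) ->
  (\int[P]_x (f x)%:E <= b%:E)%E -> (\int[P]_x (c * f x)%:E <= (c * b)%:E)%E.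
Proof.
move=> c0 mf f0 fb.
have mEf : measurable_fun [set: T] (fun z => (f z)%:E) by exact/measurable_EFinP.
have Ef0 z : (0 <= (f z)%:E)%E by rewrite lee_fin.
under eq_integral do rewrite EFinM.
rewrite ge0_integralZl// EFinM.
by apply: lee_wpmul2l; rewrite ?lee_fin.
Qed.

Lemma le_integral_quadratic (R : realType) (P : probability R R) (c e eta : R) :
  0 <= c -> 0 <= e -> (\int[P]_x (x ^+ 2)%:E <= eta%:E)%E ->
  (\int[P]_x (c * x ^+ 2 + e)%:E <= (c * eta + e)%:E)%E.
Proof.
move=> c0 e0 P2.
have mx2 : measurable_fun [set: R] (fun x : R => (x ^+ 2)%:E).
  exact/measurable_EFinP/measurable_funX.
have x20 (x : R) : (0 <= (x ^+ 2)%:E)%E by rewrite lee_fin sqr_ge0.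
have cx20 (x : R) : (0 <= c%:E * (x ^+ 2)%:E)%E by rewrite mule_ge0.
have mcx2 : measurable_fun [set: R] (fun x : R => c%:E * (x ^+ 2)%:E)%E.
  by apply: emeasurable_funM => //; exact: measurable_cst.
under eq_integral do rewrite EFinD EFinM.
rewrite ge0_integralD// ge0_integralZl//.
rewrite integral_cst//= probability_setT mule1 EFinD EFinM.
by apply: leeD => //; exact: lee_wpmul2l.
Qed.

(** The two factors share no variable, but the product space interleaves them as $a,b,o_1,o_2$. The
    variables are removed from the last to the first, each leaving the bound of its own factor. *)
Lemma le_product_integral (R : realType) d1 (O1 : measurableType d1)
    (Q1 : probability O1 R) d2 (O2 : measurableType d2) (Q2 : probability O2 R)
    (PA PB : probability R R) (F : R * O1 -> R) (G : R * O2 -> R)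
    (eta u v u' v' : R) :
  measurable_fun [set: R * O1] F -> measurable_fun [set: R * O2] G ->
  (forall z, 0 <= F z) -> (forall z, 0 <= G z) ->
  0 <= eta -> 0 <= u -> 0 <= v -> 0 <= u' -> 0 <= v' ->
  (forall a, \int[Q1]_o (F (a, o))%:E <= (u * a ^+ 2 + v)%:E)%E ->
  (forall b, \int[Q2]_o (G (b, o))%:E <= (u' * b ^+ 2 + v')%:E)%E ->
  (\int[PA]_x (x ^+ 2)%:E <= eta%:E)%E ->
  (\int[PB]_x (x ^+ 2)%:E <= eta%:E)%E ->
  (\int[((PA \x PB) \x Q1) \x Q2]_w
     (F (w.1.1.1, w.1.2) * G (w.1.1.2, w.2))%:E
   <= ((u * eta + v) * (u' * eta + v'))%:E)%E.
Proof.
move=> mF mG F0 G0 eta0 u0 v0 u'0 v'0 intF intG PA2 PB2.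
have mquad (c e : R) : measurable_fun [set: R] (fun x : R => (c * x ^+ 2 + e)).
  by apply: measurable_funD => //; apply: measurable_funM => //; exact: measurable_funX.
have quad0 (c e x : R) : 0 <= c -> 0 <= e -> 0 <= c * x ^+ 2 + e.
  by move=> c0 e0; rewrite addr_ge0// mulr_ge0// sqr_ge0.
have mG2 b : measurable_fun [set: O2] (fun o => G (b, o)).
  exact: (measurableT_comp mG (measurable_fun_pair (measurable_cst _) (@measurable_id _ _ _))).
have mF2 a : measurable_fun [set: O1] (fun o => F (a, o)).
  exact: (measurableT_comp mF (measurable_fun_pair (measurable_cst _) (@measurable_id _ _ _))).
have n_a : measurable_fun [set: (R * R) * O1] (fun w => w.1.1).
  exact: (measurableT_comp measurable_fst measurable_fst).
have n_b : measurable_fun [set: (R * R) * O1] (fun w => w.1.2).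
  exact: (measurableT_comp measurable_snd measurable_fst).
have n_o := @measurable_snd _ _ (R * R)%type O1.
have m_1 := @measurable_fst _ _ ((R * R) * O1)%type O2.
have m_2 := @measurable_snd _ _ ((R * R) * O1)%type O2.
pose f1 (w : ((R * R) * O1) * O2) := F (w.1.1.1, w.1.2) * G (w.1.1.2, w.2).
pose f2 (w : (R * R) * O1) := (u' * w.1.2 ^+ 2 + v') * F (w.1.1, w.2).
pose f3 (z : R * R) := (u * z.1 ^+ 2 + v) * (u' * z.2 ^+ 2 + v').
pose f4 (a : R) := (u' * eta + v') * (u * a ^+ 2 + v).
have mf1 : measurable_fun [set: ((R * R) * O1) * O2] f1.
  apply: measurable_funM.
    exact: (measurableT_comp mF (measurable_fun_pair
      (measurableT_comp n_a m_1) (measurableT_comp n_o m_1))).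
  exact: (measurableT_comp mG (measurable_fun_pair (measurableT_comp n_b m_1) m_2)).
have mf2 : measurable_fun [set: (R * R) * O1] f2.
  apply: measurable_funM; first exact: (measurableT_comp (mquad u' v') n_b).
  exact: (measurableT_comp mF (measurable_fun_pair n_a n_o)).
have mf3 : measurable_fun [set: R * R] f3.
  apply: measurable_funM; first exact: (measurableT_comp (mquad u v) measurable_fst).
  exact: (measurableT_comp (mquad u' v') measurable_snd).
have mf4 : measurable_fun [set: R] f4 by apply: measurable_funM.
pose P2 : probability (R * R)%type R := (PA \x PB)%E.
pose P3 : probability ((R * R) * O1)%type R := (P2 \x Q1)%E.
have le1 : (\int[P3 \x Q2]_w (f1 w)%:E <= \int[P3]_w (f2 w)%:E)%E.
  apply: le_fubini => // [w|w]; first by rewrite mulr_ge0.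
  have -> : f2 w = F (w.1.1, w.2) * (u' * w.1.2 ^+ 2 + v') by exact: mulrC.
  rewrite /f1 /=.
  exact: (le_integralZ (F0 _) (mG2 _) (fun _ => G0 _) (intG _)).
have le2 : (\int[P2 \x Q1]_w (f2 w)%:E <= \int[P2]_z (f3 z)%:E)%E.
  apply: le_fubini => // [w|z]; first by rewrite mulr_ge0// quad0.
  have -> : f3 z = (u' * z.2 ^+ 2 + v') * (u * z.1 ^+ 2 + v) by exact: mulrC.
  rewrite /f2 /=.
  exact: (le_integralZ (quad0 _ _ _ u'0 v'0) (mF2 _) (fun _ => F0 _) (intF _)).
have le3 : (\int[PA \x PB]_z (f3 z)%:E <= \int[PA]_a (f4 a)%:E)%E.
  apply: le_fubini => // [w|a]; first by rewrite mulr_ge0// quad0.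
  have -> : f4 a = (u * a ^+ 2 + v) * (u' * eta + v') by exact: mulrC.
  rewrite /f3 /=; apply: (le_integralZ (quad0 _ _ _ u0 v0) (mquad u' v')).
    by move=> b; exact: quad0.
  exact: le_integral_quadratic.
apply: le_trans le1 _; apply: le_trans le2 _; apply: le_trans le3 _.
rewrite (mulrC (u * eta + v)) /f4.
apply: (le_integralZ _ (mquad u v)); first by rewrite addr_ge0// mulr_ge0.
- by move=> a; exact: quad0.
- exact: le_integral_quadratic.
Qed.

(** * The layered noise and its decoding *)

(* With alpha_i = node i, node i adds to its input the noise
   z_0 - s^3 alpha_i^(n+1) z_0 + s^2 \sum_(1 <= k <= n) alpha_i^k z_k.
   The scales satisfy s^3 << s^2, which hides the term in s^3 from any n+1
   colluding nodes, and (s^2)^2 << s^3, which makes it visible to n+2 nodes. *)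
Definition node (R : realType) (i : nat) : R := - (i.+1)%:R.

(** Index [0] holds degree [n.+1], so [z_0] itself is what the top coefficient reveals. The minus
    sign makes $1+s^3q_0\ge1$ the denominator in [privacy_shift]. *)
Definition perturbation_coef (R : realType) (n : nat) (s : R) (i k : nat) : R :=
  if k == 0%N then - s * node R i ^+ n.+1 else node R i ^+ k.

Definition perturbation (R : realType) (n : nat) (s : R) (z : 'I_n.+1 -> R)
    (i : nat) : R :=
  \sum_(k < n.+1) perturbation_coef n s i k * z k.

Definition noise (R : realType) (n : nat) (s : R) (z : 'I_n.+1 -> R) (i : nat) : R :=
  z ord0 + s ^+ 2 * perturbation s z i.

Lemma node_inj (R : realType) : injective (@node R).
Proof. by move=> i j /oppr_inj /eqP; rewrite eqr_nat => /eqP []. Qed.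

Lemma noiseD (R : realType) (n : nat) (s : R) (z v : 'I_n.+1 -> R) (i : nat) :
  noise s (fun k => z k + v k) i = noise s z i + noise s v i.
Proof.
rewrite /noise /perturbation; under eq_bigr do rewrite mulrDr.
rewrite big_split /=; ring.
Qed.

(* Changing the input by x amounts to shifting the independent coordinates:
   z_0 by at most |x|, and the others by O(s). *)
Lemma privacy_shift (R : realType) (n N : nat) (t : 'I_n.+1 -> 'I_N) (s x : R) :
  0 <= s -> s * (N.+1 ^ n.+1)%:R <= 1 -> `|x| <= 1 ->
  exists v : 'I_n.+1 -> R,
    (forall k, `|v k| <= 1) /\ forall j, noise s v (t j) = x.
Proof.
move=> s0 sN x1; have [q [q0 qE]] := collusion_coefficients R t.
have q00 : 0 <= q ord0 by case/andP: (q0 ord0).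
have den : 1 <= 1 + s ^+ 3 * q ord0 by rewrite lerDl mulr_ge0 ?exprn_ge0.
have den0 : 0 < 1 + s ^+ 3 * q ord0 by exact: lt_le_trans den.
(* At the colluding nodes $-\alpha^{n+1}=\sum_k q_k\alpha^k$. The shifts $-sq_kv_0$ of the $z_k$
   cancel the degrees 1 to $n$ of $s^3v_0\sum_k q_k\alpha^k$, and $(1+s^3q_0)v_0=x$ remains. *)
pose v0 := x / (1 + s ^+ 3 * q ord0).
have v01 : `|v0| <= 1.
  rewrite normrM normfV (gtr0_norm den0) ler_pdivrMr// mul1r.
  exact: le_trans den.
pose v (k : 'I_n.+1) := if k == ord0 then v0 else - (s * q k * v0).
exists v; split=> [k|j].
  rewrite /v; case: ifP => // _; case/andP: (q0 k) => qk0 qkN.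
  rewrite normrN 2!normrM (ger0_norm s0) (ger0_norm qk0).
  have sq : s * q k <= 1 by apply: le_trans sN; exact: ler_wpM2l.
  have sq0 : 0 <= s * q k by exact: mulr_ge0.
  exact: mulr_ile1.
have := qE j; rewrite -[- (t j).+1%:R]/(node R (t j)) big_ord_recl expr0 mulr1.
rewrite /noise /perturbation big_ord_recl /perturbation_coef /= /v eqxx.
set A := \sum_(k < n) _ => a_eq.
rewrite (_ : \sum_(k < n) _ = - s * v0 * A); last first.
  by rewrite mulr_sumr; apply: eq_bigr => k _ /=; ring.
have -> : node R (t j) ^+ n.+1 = - (q ord0 + A) by rewrite -a_eq opprK.
by rewrite /v0; field; rewrite gt_eqF.
Qed.

Lemma sum_perturbation (R : realType) (n N : nat) (s : R) (z : 'I_n.+1 -> R)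
    (w : 'I_N -> R) :
  \sum_i w i * perturbation s z i =
  \sum_k z k * \sum_i w i * perturbation_coef n s i k.
Proof.
under eq_bigr do rewrite mulr_sumr.
rewrite exchange_big; apply: eq_bigr => k _; rewrite mulr_sumr.
by apply: eq_bigr => i _; ring.
Qed.

(* Up to O(s), w0 extracts (a + z_0)(b + y_0) and w1 / s^3 extracts
   -((a + z_0) y_0 + (b + y_0) z_0). *)
Lemma decoding_identity (R : realType) (n N : nat) (s alpha a b : R)
    (w0 w1 : 'I_N -> R) (z y : 'I_n.+1 -> R) :
  s != 0 ->
  (forall k, (k <= n.+1)%N -> \sum_i w0 i * node R i ^+ k = (k == 0%N)%:R) ->
  (forall k, (k <= n.+1)%N -> \sum_i w1 i * node R i ^+ k = (k == n.+1)%:R) ->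
  \sum_i ((2 * alpha - alpha ^+ 2) * w0 i + alpha / s ^+ 3 * w1 i) *
      ((a + noise s z i) * (b + noise s y i)) - a * b =
  - (((1 - alpha) * a - alpha * z ord0) * ((1 - alpha) * b - alpha * y ord0)) +
  s * \sum_i (s ^+ 3 * (2 * alpha - alpha ^+ 2) * w0 i + alpha * w1 i) *
      (perturbation s z i * perturbation s y i).
Proof.
move=> s0 w0E w1E.
have coefE (w : 'I_N -> R) (k0 : nat) :
    (forall k, (k <= n.+1)%N -> \sum_i w i * node R i ^+ k = (k == k0)%:R) ->
    forall k : 'I_n.+1, \sum_i w i * perturbation_coef n s i k =
      if k == ord0 then - s * (n.+1 == k0)%:R else (k == k0 :> nat)%:R.
  move=> wE k; rewrite /perturbation_coef -val_eqE /=; case: ifP => _.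
    by rewrite -wE// mulr_sumr; apply: eq_bigr => i _; ring.
  by rewrite -wE// ltnW.
have pert0 (u : 'I_n.+1 -> R) : \sum_i w0 i * perturbation s u i = 0.
  rewrite sum_perturbation big1// => k _; rewrite (coefE w0 0%N)//.
  rewrite (_ : (k == 0 :> nat)%N = (k == ord0)); last by rewrite -val_eqE.
  by case: (k == ord0); rewrite /= mulr0n !mulr0.
have pert1 (u : 'I_n.+1 -> R) : \sum_i w1 i * perturbation s u i = - s * u ord0.
  rewrite sum_perturbation (bigD1 ord0)// (coefE w1 n.+1)// !eqxx big1 => [|k k0].
    by rewrite /= mulr1n; ring.
  rewrite (coefE w1 n.+1)// (negbTE k0) (_ : (k == n.+1 :> nat) = false).
    by rewrite /= mulr0n mulr0.
  by apply/negbTE; rewrite neq_ltn ltn_ord.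
(* Only the last sum is quadratic in the perturbations; its factor $s^4$ against the division of
   [w1] by $s^3$ leaves the factor $s$ of the residual. *)
have expand (w : 'I_N -> R) (U V : R) : \sum_i w i *
    ((U + s ^+ 2 * perturbation s z i) * (V + s ^+ 2 * perturbation s y i)) =
    U * V * (\sum_i w i) + s ^+ 2 * V * (\sum_i w i * perturbation s z i) +
    s ^+ 2 * U * (\sum_i w i * perturbation s y i) +
    s ^+ 4 * (\sum_i w i * (perturbation s z i * perturbation s y i)).
  by rewrite !mulr_sumr -!big_split; apply: eq_bigr => i _ /=; ring.
have sum0 : \sum_i w0 i = 1.
  by rewrite -[RHS](w0E 0%N)//; apply: eq_bigr => i _; rewrite expr0 mulr1.
have sum1 : \sum_i w1 i = 0.
  by rewrite -[RHS](w1E 0%N)//; apply: eq_bigr => i _; rewrite expr0 mulr1.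
have e0 := expand w0 (a + z ord0) (b + y ord0).
have e1 := expand w1 (a + z ord0) (b + y ord0).
rewrite sum0 !pert0 in e0; rewrite sum1 !pert1 in e1.
rewrite (_ : \sum_i _ * ((a + _) * _) =
    (2 * alpha - alpha ^+ 2) * \sum_i w0 i *
      ((a + z ord0 + s ^+ 2 * perturbation s z i) *
       (b + y ord0 + s ^+ 2 * perturbation s y i)) +
    alpha / s ^+ 3 * \sum_i w1 i *
      ((a + z ord0 + s ^+ 2 * perturbation s z i) *
       (b + y ord0 + s ^+ 2 * perturbation s y i))); last first.
  by rewrite !mulr_sumr -big_split; apply: eq_bigr => i _; rewrite /noise /=; ring.
rewrite {}e0 {}e1.
rewrite (_ : \sum_i (s ^+ 3 * _ * _ + _) * _ =
    s ^+ 3 * (2 * alpha - alpha ^+ 2) *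
      (\sum_i w0 i * (perturbation s z i * perturbation s y i)) +
    alpha * (\sum_i w1 i * (perturbation s z i * perturbation s y i))); last first.
  by rewrite !mulr_sumr -big_split; apply: eq_bigr => i _ /=; ring.
by field.
Qed.

(** * Size of the perturbation and of the estimation error *)

Lemma sqr_sum_le (R : realFieldType) (I : finType) (x : I -> R) :
  (\sum_i x i) ^+ 2 <= #|I|%:R * \sum_i x i ^+ 2.
Proof.
rewrite expr2 big_distrlr /=.
apply: (@le_trans _ _ (\sum_i \sum_j (x i ^+ 2 / 2 + x j ^+ 2 / 2))).
  apply: ler_sum => i _; apply: ler_sum => j _.
  by have := sqr_ge0 (x i - x j); nra.
have const (c : R) : \sum_(j : I) c = #|I|%:R * c by rewrite sumr_const mulr_natl.
have inner i : \sum_j (x i ^+ 2 / 2 + x j ^+ 2 / 2) =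
    #|I|%:R * (x i ^+ 2 / 2) + (\sum_j x j ^+ 2) / 2.
  by rewrite big_split /= const mulr_suml.
rewrite (eq_bigr _ (fun i _ => inner i)) big_split /= const -mulr_sumr -mulr_suml.
by rewrite le_eqVlt; apply/orP; left; apply/eqP; field.
Qed.

(** Cauchy-Schwarz, with coefficients of size at most $N^{n+1}$: nodes are at most $N$ in absolute
    value, degrees at most $n+1$, and $s\le1$. *)
Lemma perturbation_bound (R : realType) (n N : nat) (s : R) (z : 'I_n.+1 -> R)
    (i : 'I_N) :
  0 <= s <= 1 ->
  perturbation s z i ^+ 2 <=
    (n.+1)%:R * (N ^ n.+1)%:R ^+ 2 * \sum_k z k ^+ 2.
Proof.
move=> /andP[s0 s1].
have coef_le k : (k <= n)%N -> `|perturbation_coef n s i k| <= (N ^ n.+1)%:R.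
  move=> kn; have nodeX m : (m <= n.+1)%N -> `|node R i ^+ m| <= (N ^ n.+1)%:R.
    move=> mn; rewrite normrX normrN normr_nat natrX.
    apply: (@le_trans _ _ (N%:R ^+ m)); first by rewrite lerXn2r ?nnegrE// ler_nat.
    by rewrite ler_weXn2l// ler1n (leq_ltn_trans _ (ltn_ord i)).
  rewrite /perturbation_coef; case: ifP => _; last by rewrite nodeX// ltnW.
  rewrite normrM normrN (ger0_norm s0); apply: le_trans (nodeX n.+1 _) => //.
  exact: ler_piMl.
apply: le_trans (sqr_sum_le _) _; rewrite card_ord -mulrA ler_wpM2l//.
rewrite mulr_sumr; apply: ler_sum => k _; rewrite exprMn ler_wpM2r ?sqr_ge0//.
by rewrite -real_normK ?num_real// lerXn2r ?nnegrE// coef_le// -ltnS.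
Qed.

(** The linear MMSE $f(v)=\eta v/(\eta+v)$ is 1-Lipschitz and at most $\eta$, so its squares at [v]
    and [v'] differ by at most $2\eta(v'-v)$; for $v>0$ the fraction on the right is $f(v)^2$. *)
Lemma estimation_error_le (R : realFieldType) (eta v v' : R) :
  0 <= eta -> 0 <= v -> v < v' ->
  (eta * v' / (eta + v')) ^+ 2 <=
  eta ^+ 2 / (1 + eta / v) ^+ 2 + 2 * eta * (v' - v).
Proof.
move=> eta0 v0 vv'.
have v'0 : 0 < v' by exact: le_lt_trans vv'.
have d0 : 0 < eta + v' by rewrite ltr_wpDl.
have fle : eta * v' / (eta + v') <= eta.
  by rewrite ler_pdivrMr//; apply: ler_wpM2l => //; rewrite lerDr.
have f0 : 0 <= eta * v' / (eta + v') by rewrite divr_ge0 ?mulr_ge0// ltW.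
(* Division by zero yields 0, so at [v = 0] the fraction is $\eta^2$ and $f\le\eta$ suffices. *)
have [veq|vneq] := eqVneq v 0.
  rewrite veq invr0 mulr0 addr0 expr1n divr1 subr0.
  apply: (@le_trans _ _ (eta ^+ 2)); first by rewrite lerXn2r ?nnegrE.
  by rewrite lerDl !mulr_ge0// ltW.
have {v0 vneq} v0 : 0 < v by rewrite lt_neqAle eq_sym vneq.
have e0 : 0 < eta + v by rewrite ltr_wpDl.
have -> : eta ^+ 2 / (1 + eta / v) ^+ 2 = (eta * v / (eta + v)) ^+ 2.
  by field; rewrite !gt_eqF// addrC.
have g0 : 0 <= eta * v / (eta + v) by rewrite divr_ge0 ?mulr_ge0// ltW.
have gle : eta * v / (eta + v) <= eta.
  by rewrite ler_pdivrMr//; apply: ler_wpM2l => //; rewrite lerDr.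
have fg : eta * v' / (eta + v') - eta * v / (eta + v) <= v' - v.
  have -> : eta * v' / (eta + v') - eta * v / (eta + v) =
      eta ^+ 2 / ((eta + v') * (eta + v)) * (v' - v).
    by field; rewrite !gt_eqF.
  apply: ler_piMl; first by rewrite subr_ge0 ltW.
  by rewrite ler_pdivrMr ?mulr_gt0// mul1r; nra.
have fg0 : 0 <= v' - v by rewrite subr_ge0 ltW.
move: f0 fle g0 gle fg; set f := eta * v' / _; set g := eta * v / _ => f0 fle g0 gle fg.
have : (f - g) * (f + g) <= (v' - v) * (2 * eta).
  by nra.
nra.
Qed.

(** * Moments and privacy of the layered noise *)

Lemma law_moments (R : realType) d (Om : measurableType d) (P : probability Om R)
    (mu : probability R R) (X : Om -> R) :
  measurable_fun [set: Om] X ->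
  (forall D, measurable D -> P (X @^-1` D) = mu D) ->
  finite_variance mu ->
  [/\ P.-integrable setT (fun w => (X w ^+ 2)%:E),
      P.-integrable setT (fun w => (X w)%:E),
      (\int[P]_w (X w ^+ 2)%:E = \int[mu]_x (x ^+ 2)%:E)%E &
      (\int[P]_w (X w)%:E = \int[mu]_x x%:E)%E].
Proof.
move=> mX law /finite_varianceP fmu.
have mx2 : measurable_fun [set: R] (fun x : R => (x ^+ 2)%:E).
  exact/measurable_EFinP/measurable_funX.
have mu_eq (f : R -> \bar R) : (\int[mu]_x f x = \int[pushforward P X]_x f x)%E.
  by apply: eq_measure_integral => A mA _; exact/esym/law.
have E2 : (\int[P]_w (X w ^+ 2)%:E = \int[mu]_x (x ^+ 2)%:E)%E.
  rewrite mu_eq ge0_integral_pushforward// => x _.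
  by rewrite lee_fin sqr_ge0.
have iX2 : P.-integrable setT (fun w => (X w ^+ 2)%:E).
  apply/integrableP; split.
    exact/measurable_EFinP/measurable_funX.
  rewrite (_ : integral _ _ _ = \int[P]_w (X w ^+ 2)%:E)%E; first by rewrite E2.
  by apply: eq_integral => w _; rewrite gee0_abs ?lee_fin ?sqr_ge0.
have [iX _] := quadratic_integral mX iX2.
by split=> //; rewrite mu_eq integral_pushforward.
Qed.

Lemma measurable_perturbation (R : realType) d (Om : measurableType d) (n : nat)
    (s : R) (Z : 'I_n.+1 -> Om -> R) (i : nat) :
  (forall k, measurable_fun [set: Om] (Z k)) ->
  measurable_fun [set: Om] (fun w => perturbation s (fun k => Z k w) i).
Proof.
move=> mZ; apply: measurable_sum => k.
exact: measurable_funM.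
Qed.

Lemma measurable_noise (R : realType) d (Om : measurableType d) (n : nat)
    (s : R) (Z : 'I_n.+1 -> Om -> R) (i : nat) :
  (forall k, measurable_fun [set: Om] (Z k)) ->
  measurable_fun [set: Om] (fun w => noise s (fun k => Z k w) i).
Proof.
move=> mZ; apply: measurable_funD; first exact: mZ.
by apply: measurable_funM => //; exact: measurable_perturbation.
Qed.

Lemma integral_noise (R : realType) d (Om : measurableType d) (P : probability Om R)
    (n : nat) (s : R) (Z : 'I_n.+1 -> Om -> R) (i : nat) :
  (forall k, P.-integrable setT (fun w => (Z k w)%:E)) ->
  (forall k, \int[P]_w (Z k w)%:E = 0)%E ->
  P.-integrable setT (fun w => (noise s (fun k => Z k w) i)%:E) /\
  (\int[P]_w (noise s (fun k => Z k w) i)%:E = 0)%E.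
Proof.
move=> iZ Z0.
have iter (c : 'I_n.+1 -> R) :
    P.-integrable setT (fun w => \sum_(k < n.+1) (c k)%:E * (Z k w)%:E)%E /\
    (\int[P]_w (\sum_(k < n.+1) (c k)%:E * (Z k w)%:E) = 0)%E.
  have ick k : P.-integrable setT (fun w => (c k)%:E * (Z k w)%:E)%E.
    exact: integrableZl.
  split; first by apply: integrable_sum => // k _; exact: ick.
  rewrite integral_sum//; apply: big1 => k _.
  by rewrite integralZl// Z0 mule0.
pose c (k : 'I_n.+1) := (k == ord0)%:R + s ^+ 2 * perturbation_coef n s i k.
have noiseE w : (noise s (fun k => Z k w) i)%:E = (\sum_(k < n.+1) (c k)%:E * (Z k w)%:E)%E.
  under eq_bigr do rewrite -EFinM.
  rewrite sumEFin; congr EFin; rewrite /noise /perturbation mulr_sumr.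
  rewrite [RHS](eq_bigr (fun k => (k == ord0)%:R * Z k w +
      s ^+ 2 * (perturbation_coef n s i k * Z k w))); last first.
    by move=> k _; rewrite /c mulrDl mulrA.
  rewrite big_split /=; congr (_ + _).
  rewrite (bigD1 ord0)//= big1 => [|k /negbTE ->]; last by rewrite mul0r.
  by rewrite mul1r addr0.
have [i1 i2] := iter c.
split; first by apply: eq_integrable i1 => // w _.
by rewrite -[RHS]i2; apply: eq_integral => w _.
Qed.

Lemma private_noise (R : realType) (n : nat) (eps delta : R) :
  0 < eps -> 0 < delta ->
  exists (d : measure_display) (Om : measurableType d) (Q : probability Om R)
         (Z : 'I_n.+1 -> Om -> R) (S : R),
    [/\ forall k, measurable_fun [set: Om] (Z k),
        forall k, Q.-integrable setT (fun w => (Z k w ^+ 2)%:E) /\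
          Q.-integrable setT (fun w => (Z k w)%:E),
        forall k, (\int[Q]_w (Z k w)%:E = 0)%E /\
          (\int[Q]_w (Z k w ^+ 2)%:E <= S%:E)%E,
        (\int[Q]_w (Z ord0 w ^+ 2)%:E <= (sigma_star_sq eps + delta)%:E)%E &
        forall (N : nat) (s : R), 0 <= s -> s * (N.+1 ^ n.+1)%:R <= 1 ->
          T_node_DP n.+1 eps Q (fun (i : 'I_N) w => noise s (fun k => Z k w) i)].
Proof.
move=> e0 d0; have [P0 [theta [/andP[th0 th_eps] fP0 P01 P02 P0sh]]] := strict_noise e0 d0.
(* The gap between [ln theta] and [eps] is cut into [n.+1] shares; the [n] coordinates other than
   [z_0] spend one each. *)
pose kappa := (eps - ln theta) / n.+1%:R.
have k0 : 0 < kappa.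
  by rewrite divr_gt0// subr_gt0 -ltr_expR lnK ?posrE.
have [L0 [fL0 L0sh _]] := scaled_heavy_tailed_probability k0.
have [L [fL L1 L2 Lsh]] := centered_probability fL0.
pose mu (k : 'I_n.+1) := if k == ord0 then P0 else L.
have [d [Om [Q [Z [mZ lawZ shZ]]]]] := independent_coordinates mu.
have fmu k : finite_variance (mu k) by rewrite /mu; case: ifP.
have mom k := law_moments (mZ k) (lawZ k) (fmu k).
have x20 (P : probability R R) : (0 <= \int[P]_x (x ^+ 2)%:E)%E.
  by apply: integral_ge0 => x _; rewrite lee_fin sqr_ge0.
exists d, Om, Q, Z, (sigma_star_sq eps + delta + variance_of L0); split=> //.
- by move=> k; have [] := mom k.
- move=> k; have [_ _ -> ->] := mom k.
  have P0v : 0 <= sigma_star_sq eps + delta.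
    by rewrite -lee_fin (le_trans (x20 P0)).
  have Lv : 0 <= variance_of L0 by rewrite -lee_fin -L2.
  rewrite /mu; case: ifP => _; split=> //.
    by apply: le_trans P02 _; rewrite lee_fin lerDl.
  by rewrite L2 lee_fin lerDr.
- by have [_ _ -> _] := mom ord0; rewrite /mu eqxx.
move=> N s s0 sN t _ x0 x1 x01 B mB.
have [v [v1 noisev]] := privacy_shift t s0 sN x01.
pose K (k : 'I_n.+1) := if k == ord0 then theta else expR kappa.
have K0 k : 0 <= K k by rewrite /K; case: ifP => _; rewrite ?expR_ge0// ltW.
have muK k : shift_ratio (mu k) (v k) (K k).
  rewrite /mu /K; case: ifP => _; first exact: P0sh.
  by apply: Lsh; exact: L0sh.
have [sh [msh Zsh Qsh]] := shZ v K K0 muK.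
have mA : measurable [set w | B (fun j => x1 + noise s (fun k => Z k w) (t j))].
  apply: (@measurable_borel_vec _ _ _ _
    (fun j w => x1 + noise s (fun k => Z k w) (t j))) => // j.
  by apply: measurable_funD => //; exact: measurable_noise.
(* By linearity of the noise, shifting the coordinates by [v] adds [x0 - x1] at every colluding
   node. *)
have -> : [set w | B (fun j => x0 + noise s (fun k => Z k w) (t j))] =
    sh @^-1` [set w | B (fun j => x1 + noise s (fun k => Z k w) (t j))].
  apply/funext => w /=; congr B; apply/funext => j.
  rewrite (_ : (fun k => Z k (sh w)) = (fun k => Z k w + v k)); last first.
    by apply/funext => k; exact: Zsh.
  by rewrite noiseD noisev; ring.
apply: le_trans (Qsh _ mA) _; apply: lee_wpmul2r => //; rewrite lee_fin.
rewrite big_ord_recl /K eqxx /= prodr_const card_ord -expRM_natl.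
rewrite -[X in X * _](lnK (_ : theta \is Num.pos)) ?posrE// -expRD ler_expR.
rewrite -lerBrDl /kappa mulrCA ler_piMr ?subr_ge0 ?ler_pdivrMr ?mul1r ?ler_nat//.
by rewrite -ler_expR lnK ?posrE// ltW.
Qed.

(** Cauchy-Schwarz over the nodes. The bound splits into a function of [z] times one of [y], ready
    for [le_product_integral], and its constant does not involve [s], which is chosen later. *)
Lemma residual_bound (R : realType) (n N : nat) (s W : R) (c : 'I_N -> R)
    (z y : 'I_n.+1 -> R) :
  0 <= s <= 1 -> (forall i, `|c i| <= W) ->
  (\sum_i c i * (perturbation s z i * perturbation s y i)) ^+ 2 <=
  N%:R * (N%:R * (W ^+ 2 * ((n.+1)%:R * (N ^ n.+1)%:R ^+ 2) ^+ 2)) *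
  ((\sum_k z k ^+ 2) * (\sum_k y k ^+ 2)).
Proof.
move=> s01 cW.
have zM i := @perturbation_bound R n N s z i s01.
have yM i := @perturbation_bound R n N s y i s01.
have M0 : 0 <= (n.+1)%:R * (N ^ n.+1)%:R ^+ 2 :> R by rewrite mulr_ge0 ?sqr_ge0.
move: (_ * _ ^+ 2) M0 zM yM => M M0 zM yM.
have Sz : 0 <= \sum_k z k ^+ 2 by apply: sumr_ge0 => k _; exact: sqr_ge0.
have Sy : 0 <= \sum_k y k ^+ 2 by apply: sumr_ge0 => k _; exact: sqr_ge0.
apply: le_trans (sqr_sum_le _) _; rewrite card_ord -!mulrA; apply: ler_wpM2l => //.
rewrite [leRHS]mulr_natl -[X in _ *+ X](card_ord N) -sumr_const.
apply: ler_sum => i _; rewrite 2!exprMn.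
have c2 : c i ^+ 2 <= W ^+ 2.
  rewrite -real_normK ?num_real// lerXn2r ?nnegrE//.
  exact: le_trans (normr_ge0 _) (cW i).
rewrite (_ : W * _ = W ^+ 2 * ((M * \sum_k z k ^+ 2) * (M * \sum_k y k ^+ 2))); last by ring.
have rho_tau : perturbation s z i ^+ 2 * perturbation s y i ^+ 2 <=
    (M * \sum_k z k ^+ 2) * (M * \sum_k y k ^+ 2).
  by apply: ler_pM; rewrite ?sqr_ge0.
by apply: ler_pM => //; rewrite ?sqr_ge0// mulr_ge0 ?sqr_ge0.
Qed.

(** * Erasures and the complete scheme *)

Lemma erased_decoding (R : realType) (N : nat) (Er : {set 'I_N}) (c : 'I_N -> R)
    (a b : R) (r t : 'I_N -> R) :
  (forall i, i \in Er -> c i = 0) ->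
  \sum_i c i * odflt 0 (received Er a b r t i) =
  \sum_i c i * ((a + r i) * (b + t i)).
Proof.
move=> c0; apply: eq_bigr => i _; rewrite /received.
by case: ifP => // iE; rewrite c0// !mul0r.
Qed.

(** The decoder sees the received vector alone; this lets its weights depend on the erased set. *)
Lemma received_erasures (R : realType) (N : nat) (Er : {set 'I_N}) (a b : R)
    (r t : 'I_N -> R) :
  [set i | received Er a b r t i == None]%SET = Er.
Proof.
by apply/setP => i; rewrite inE /received; case: ifP.
Qed.

(** At least [T + 1] nodes survive, enough to read off any coefficient of a polynomial of degree at
    most [T]. Choice makes the weights a function of the erased set. *)
Lemma survivor_weights (R : realType) (N T E k0 : nat) :
  (T + E + 1 <= N)%N ->
  exists w : {set 'I_N} -> 'I_N -> R, forall Er : {set 'I_N}, (#|Er| <= E)%N ->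
    (forall i, i \in Er -> w Er i = 0) /\
    forall k, (k <= T)%N -> \sum_i w Er i * node R i ^+ k = (k == k0)%:R.
Proof.
move=> TEN.
have weights (Er : {set 'I_N}) : exists w : 'I_N -> R, (#|Er| <= E)%N ->
    (forall i, i \in Er -> w i = 0) /\
    forall k, (k <= T)%N -> \sum_i w i * node R i ^+ k = (k == k0)%:R.
  have [ErE|ErE] := leqP #|Er| E; last by exists (fun=> 0).
  have TS : (T < #|~: Er|)%N.
    by have := cardsC Er; rewrite card_ord; move: TEN ErE; lia.
  have [w [w0 wE]] := interpolation_weights k0 (@node_inj R) TS.
  by exists w => _; split=> // i iE; apply: w0; rewrite inE iE.
by have [w wP] := choice weights; exists w.
Qed.

(** Without colluding nodes there is nothing to hide: no noise is added, and any surviving node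
    returns the exact product. *)
Lemma uncoded_scheme (R : realType) (N E : nat) (eta eps gamma : R) :
  (0 + E + 1 <= N)%N -> 0 < eps -> 0 < gamma ->
  exists (d1 : measure_display) (O1 : measurableType d1) (Q1 : probability O1 R)
         (d2 : measure_display) (O2 : measurableType d2) (Q2 : probability O2 R)
         (Rn : 'I_N -> O1 -> R) (Sn : 'I_N -> O2 -> R)
         (dec : ('I_N -> option R) -> R),
    [/\ zero_mean_family Q1 Rn /\ zero_mean_family Q2 Sn,
        T_node_DP 0 eps Q1 Rn, T_node_DP 0 eps Q2 Sn,
        (forall Er : {set 'I_N},
           measurable_fun setT
             (fun w : ((R * R) * O1) * O2 =>
                dec (received Er w.1.1.1 w.1.1.2
                       (fun i => Rn i w.1.2) (fun i => Sn i w.2))))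
      & forall PA PB : probability R R,
          (\int[PA]_x (x ^+ 2)%:E <= eta%:E)%E ->
          (\int[PB]_x (x ^+ 2)%:E <= eta%:E)%E ->
          forall Er : {set 'I_N}, (#|Er| <= E)%N ->
            (\int[((PA \x PB) \x Q1) \x Q2]_w
               ((dec (received Er w.1.1.1 w.1.1.2
                        (fun i => Rn i w.1.2) (fun i => Sn i w.2))
                 - w.1.1.1 * w.1.1.2) ^+ 2)%:E
             <= (eta ^+ 2 / (1 + SNR_star eta eps) ^+ 2 + gamma)%:E)%E].
Proof.
move=> EN eps0 gamma0.
pose Q : probability R R := dirac (0 : R).
pose Z (i : 'I_N) (w : R) : R := 0.
pose dec (y : 'I_N -> option R) : R :=
  if [pick i | y i != None] is Some i then odflt 0 (y i) else 0.
have meanZ : zero_mean_family Q Z.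
  move=> i; split; first exact: measurable_cst.
  by split; [exact: finite_measure_integrable_cst|exact: integral0_eq].
have DPZ : T_node_DP 0 eps Q Z.
  move=> t _ x0 x1 _ B _.
  (* Any two vectors indexed by ['I_0] are equal, so both inputs give the same event. *)
  rewrite (_ : [set w | B (fun j => x0 + Z (t j) w)] =
      [set w | B (fun j => x1 + Z (t j) w)]); last first.
    by apply/funext => w /=; congr B; apply/funext => -[].
  by apply: lee_pemull => //; rewrite lee_fin -expR0 ler_expR ltW.
have decE (Er : {set 'I_N}) (a b : R) (w1 w2 : R) :
    dec (received Er a b (fun i => Z i w1) (fun i => Z i w2)) =
    if [pick i | i \notin Er] is Some i then a * b else 0.
  rewrite /dec (@eq_pick _ _ (fun i => i \notin Er)); last first.
    by move=> i; rewrite /received; case: ifP.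
  by case: pickP => // i /negbTE iE; rewrite /received iE /= !addr0.
exists _, R, Q, _, R, Q, Z, Z, dec; split=> // [Er|PA PB _ _ Er ErE].
  under eq_fun do rewrite decE.
  case: pickP => [i _|_]; last exact: measurable_cst.
  apply: measurable_funM.
    exact: (measurableT_comp measurable_fst (measurableT_comp measurable_fst measurable_fst)).
  exact: (measurableT_comp measurable_snd (measurableT_comp measurable_fst measurable_fst)).
under eq_integral do rewrite decE.
case: pickP => [i _|no]; last first.
  have : (#|~: Er| = 0)%N by apply: eq_card0 => i; rewrite inE no.
  by have := cardsC Er; rewrite card_ord; lia.
under eq_integral do rewrite subrr expr0n /=.
by rewrite integral0 lee_fin addr_ge0 ?(ltW gamma0)// divr_ge0 ?sqr_ge0.
Qed.

(** Completing a square absorbs the cross term, so that only $m^2$ and [X], both of product form in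
    the application, have to be integrated. *)
Lemma sqr_perturbed_le (R : realFieldType) (s m e X : R) :
  0 <= s <= 1 -> e ^+ 2 <= X ->
  (- m + s * e) ^+ 2 <= (1 + s) * m ^+ 2 + 2 * s * X.
Proof.
move=> /andP[s0 s1] eX; rewrite -subr_ge0.
have -> : (1 + s) * m ^+ 2 + 2 * s * X - (- m + s * e) ^+ 2 =
  s * (m + e) ^+ 2 + 2 * s * (X - e ^+ 2) + s * (1 - s) * e ^+ 2 by ring.
have h1 : 0 <= s * (m + e) ^+ 2 by rewrite mulr_ge0 ?sqr_ge0.
have h2 : 0 <= 2 * s * (X - e ^+ 2) by rewrite !mulr_ge0 ?subr_ge0.
have h3 : 0 <= s * (1 - s) * e ^+ 2 by rewrite mulr_ge0 ?sqr_ge0// mulr_ge0 ?subr_ge0.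
lra.
Qed.

Lemma normD_weighted_le (R : realDomainType) (u v x y : R) :
  0 <= u <= 1 -> 0 <= v <= 1 -> `|u * x + v * y| <= `|x| + `|y|.
Proof.
move=> /andP[u0 u1] /andP[v0 v1]; apply: le_trans (ler_normD _ _) _.
by rewrite !normrM (ger0_norm u0) (ger0_norm v0) lerD// ler_piMl.
Qed.

Theorem theorem1 (R : realType) (N T E : nat) (eta eps : R) :
  (0 < N)%N -> (T + E + 1 <= N)%N -> 0 <= eta -> 0 < eps ->
  forall gamma : R, 0 < gamma ->
  exists (d1 : measure_display) (O1 : measurableType d1) (Q1 : probability O1 R)
         (d2 : measure_display) (O2 : measurableType d2) (Q2 : probability O2 R)
         (Rn : 'I_N -> O1 -> R) (Sn : 'I_N -> O2 -> R)
         (dec : ('I_N -> option R) -> R),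
    [/\ zero_mean_family Q1 Rn /\ zero_mean_family Q2 Sn,
        T_node_DP T eps Q1 Rn, T_node_DP T eps Q2 Sn,
        (forall Er : {set 'I_N},
           measurable_fun setT
             (fun w : ((R * R) * O1) * O2 =>
                dec (received Er w.1.1.1 w.1.1.2
                       (fun i => Rn i w.1.2) (fun i => Sn i w.2))))
      & forall PA PB : probability R R,
          (\int[PA]_x (x ^+ 2)%:E <= eta%:E)%E ->
          (\int[PB]_x (x ^+ 2)%:E <= eta%:E)%E ->
          forall Er : {set 'I_N}, (#|Er| <= E)%N ->
            (\int[((PA \x PB) \x Q1) \x Q2]_w
               ((dec (received Er w.1.1.1 w.1.1.2
                        (fun i => Rn i w.1.2) (fun i => Sn i w.2))
                 - w.1.1.1 * w.1.1.2) ^+ 2)%:E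
             <= (eta ^+ 2 / (1 + SNR_star eta eps) ^+ 2 + gamma)%:E)%E].
Proof.
move=> N0 TEN eta0 eps0 gamma gamma0.
(* The layered noise has [T] coordinates including [z_0], which requires [T] positive. *)
case: T TEN => [|n] TEN; first exact: uncoded_scheme.
(* The excess variance then costs [2 * eta * delta], at most [gamma / 4]. *)
pose delta := gamma / (8 * (eta + 1)).
have delta0 : 0 < delta by rewrite divr_gt0// mulr_gt0// ltr_wpDl.
have [d [Om [Q [Z [S [mZ iZ momZ Z02 ZDP]]]]]] := private_noise n eps0 delta0.
have [sig0 _] := sigma_star_approx eps0 delta0.
pose v := sigma_star_sq eps + delta; have v0 : 0 < v by rewrite ltr_wpDl.
(* The minimiser of $(1-\alpha)^2\eta+\alpha^2v$, with minimum $\eta v/(\eta+v)$. *)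
pose alpha := eta / (eta + v); have etav : 0 < eta + v by rewrite ltr_wpDl.
have alpha01 : 0 <= alpha <= 1.
  by rewrite divr_ge0 ?(ltW etav)//= ler_pdivrMr// mul1r lerDl ltW.
have [w0 w0P] := @survivor_weights R N n.+1 E 0 TEN.
have [w1 w1P] := @survivor_weights R N n.+1 E n.+1 TEN.
(* A bound on the weights for all erased sets at once, since [s] belongs to the scheme and cannot
   depend on the erasures. *)
pose W := \sum_(Er : {set 'I_N}) \sum_(i < N) (`|w0 Er i| + `|w1 Er i|).
have WP Er i : `|w0 Er i| + `|w1 Er i| <= W.
  rewrite /W (bigD1 Er)//= (bigD1 i)//= -addrA lerDl addr_ge0//.
    by apply: sumr_ge0 => j _; rewrite addr_ge0.
  by apply: sumr_ge0 => F _; apply: sumr_ge0 => j _; rewrite addr_ge0.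
pose K := N%:R * (N%:R * (W ^+ 2 * ((n.+1)%:R * (N ^ n.+1)%:R ^+ 2) ^+ 2)) : R.
have K0 : 0 <= K.
  by rewrite /K; apply: mulr_ge0 => //; apply: mulr_ge0 => //; apply: mulr_ge0; exact: sqr_ge0.
have S0 : 0 <= S.
  rewrite -lee_fin; have [_ ] := momZ ord0; apply: le_trans.
  by apply: integral_ge0 => w _; rewrite lee_fin sqr_ge0.
pose M := n.+1%:R * S; have M0 : 0 <= M by rewrite /M mulr_ge0.
(* [s * Bd] covers the excess of the factor [1 + s] on the main term and the integrated residual. *)
pose Bd := eta ^+ 2 + 2 * K * (M * M).
have Bd0 : 0 <= Bd.
  by apply: addr_ge0; [exact: sqr_ge0|apply: mulr_ge0; exact: mulr_ge0].
pose A : R := (N.+1 ^ n.+1)%:R.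
have A0 : 0 <= A by rewrite /A ler0n.
(* The summands ensure in turn the privacy condition [s * A <= 1], the error bound
   [s * Bd <= gamma / 2], and [s <= 1]. *)
pose den := A + 2 * Bd / gamma + 1.
have BdG : 0 <= 2 * Bd / gamma by rewrite divr_ge0 ?(ltW gamma0)// mulr_ge0.
have den0 : 0 < den by rewrite /den; lra.
pose s := den^-1; have s0 : 0 < s by rewrite invr_gt0.
have sA : s * A <= 1 by rewrite ler_pdivrMl// mulr1 /den; lra.
have s1 : s <= 1 by rewrite invf_le1// /den; lra.
have s01 : 0 <= s <= 1 by rewrite (ltW s0).
have sB : s * Bd <= gamma / 2.
  rewrite ler_pdivrMl//.
  have -> : Bd = (2 * Bd / gamma) * (gamma / 2) by field; rewrite gt_eqF.
  by rewrite ler_wpM2r ?divr_ge0 ?(ltW gamma0)// /den; lra.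
pose p := 2 * alpha - alpha ^+ 2.
pose c Er i := p * w0 Er i + alpha / s ^+ 3 * w1 Er i.
(* The default 0 at erased entries is harmless, the weights being zero there. *)
pose dec (y : 'I_N -> option R) :=
  \sum_i c [set j | y j == None]%SET i * odflt 0 (y i).
have decE Er (a b : R) (r t : 'I_N -> R) : dec (received Er a b r t) =
    \sum_i c Er i * odflt 0 (received Er a b r t i).
  by rewrite /dec received_erasures.
pose Z' (i : 'I_N) (w : Om) := noise s (fun k => Z k w) i.
have mZ' i : measurable_fun [set: Om] (Z' i) by exact: measurable_noise.
have meanZ' : zero_mean_family Q Z'.
  move=> i; split=> //.
  by apply: integral_noise => k; [case: (iZ k)|case: (momZ k)].
have DPZ' : T_node_DP n.+1 eps Q Z' by apply: ZDP => //; exact: ltW.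
have m_a : measurable_fun [set: ((R * R) * Om) * Om] (fun w => w.1.1.1).
  exact: (measurableT_comp measurable_fst (measurableT_comp measurable_fst measurable_fst)).
have m_b : measurable_fun [set: ((R * R) * Om) * Om] (fun w => w.1.1.2).
  exact: (measurableT_comp measurable_snd (measurableT_comp measurable_fst measurable_fst)).
have m_1 : measurable_fun [set: ((R * R) * Om) * Om] (fun w => w.1.2).
  exact: (measurableT_comp measurable_snd measurable_fst).
have m_2 : measurable_fun [set: ((R * R) * Om) * Om] (fun w => w.2).
  exact: measurable_snd.
have mdec Er : measurable_fun [set: ((R * R) * Om) * Om] (fun w =>
    dec (received Er w.1.1.1 w.1.1.2 (fun i => Z' i w.1.2) (fun i => Z' i w.2))).
  under eq_fun do rewrite decE.
  apply: measurable_sum => i; apply: measurable_funM => //.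
  rewrite /received; case: (i \in Er) => //=.
  apply: measurable_funM; apply: measurable_funD => //.
    exact: (measurableT_comp (mZ' i) m_1).
  exact: (measurableT_comp (mZ' i) m_2).
exists d, Om, Q, d, Om, Q, Z', Z', dec; split=> // PA PB PA2 PB2 Er ErE.
have [w0Er w0E] := w0P Er ErE; have [w1Er w1E] := w1P Er ErE.
have c_er i : i \in Er -> c Er i = 0.
  by move=> iE; rewrite /c w0Er// w1Er// !mulr0 addr0.
pose F1 (z : R * Om) := ((1 - alpha) * z.1 - alpha * Z ord0 z.2) ^+ 2.
pose F2 (z : R * Om) := \sum_(k < n.+1) Z k z.2 ^+ 2.
have F10 z : 0 <= F1 z by exact: sqr_ge0.
have F20 z : 0 <= F2 z by apply: sumr_ge0 => k _; exact: sqr_ge0.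
have mF1 : measurable_fun [set: R * Om] F1.
  apply: measurable_funX; apply: measurable_funB; apply: measurable_funM => //.
  exact: (measurableT_comp (mZ ord0) measurable_snd).
have mF2 : measurable_fun [set: R * Om] F2.
  apply: measurable_sum => k; apply: measurable_funX.
  exact: (measurableT_comp (mZ k) measurable_snd).
have intF1 a : (\int[Q]_o (F1 (a, o))%:E <=
    ((1 - alpha) ^+ 2 * a ^+ 2 + alpha ^+ 2 * v)%:E)%E.
  have [iZ2 iZ1] := iZ ord0; have [Z01 _] := momZ ord0.
  have [_ quad] := quadratic_integral (mZ ord0) iZ2.
  rewrite (_ : integral _ _ _ = \int[Q]_o (alpha ^+ 2 * Z ord0 o ^+ 2 +
      (- 2 * alpha * (1 - alpha) * a) * Z ord0 o + (1 - alpha) ^+ 2 * a ^+ 2)%:E)%E.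
    rewrite quad Z01 /= mulr0 addr0 lee_fin addrC lerD2l ler_wpM2l ?sqr_ge0//.
    by rewrite -lee_fin fineK// integrable_fin_num.
  by apply: eq_integral => o _; rewrite /F1 /=; congr EFin; ring.
have intF2 a : (\int[Q]_o (F2 (a, o))%:E <= (0 * a ^+ 2 + M)%:E)%E.
  rewrite mul0r add0r /F2 /=; under eq_integral do rewrite -sumEFin.
  rewrite ge0_integral_sum//; last 2 first.
  - by move=> k; exact/measurable_EFinP/measurable_funX.
  - by move=> k o _; rewrite lee_fin sqr_ge0.
  rewrite /M mulr_natl -[X in _ *+ X](card_ord n.+1) -sumr_const -sumEFin.
  by apply: lee_sum => k _; case: (momZ k).
pose P4 : probability (((R * R) * Om) * Om)%type R := (((PA \x PB) \x Q) \x Q)%E.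
pose G1 (w : ((R * R) * Om) * Om) := F1 (w.1.1.1, w.1.2) * F1 (w.1.1.2, w.2).
pose G2 (w : ((R * R) * Om) * Om) := F2 (w.1.1.1, w.1.2) * F2 (w.1.1.2, w.2).
have mG (F : R * Om -> R) : measurable_fun [set: R * Om] F ->
    measurable_fun [set: ((R * R) * Om) * Om]
      (fun w => F (w.1.1.1, w.1.2) * F (w.1.1.2, w.2)).
  move=> mF; apply: measurable_funM.
    exact: (measurableT_comp mF (measurable_fun_pair m_a m_1)).
  exact: (measurableT_comp mF (measurable_fun_pair m_b m_2)).
have mG1 := mG _ mF1; have mG2 := mG _ mF2.
have G10 w : 0 <= G1 w by rewrite mulr_ge0.
have G20 w : 0 <= G2 w by rewrite mulr_ge0.
have alpha20 : 0 <= (1 - alpha) ^+ 2 by exact: sqr_ge0.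
have av0 : 0 <= alpha ^+ 2 * v by rewrite mulr_ge0 ?sqr_ge0// ltW.
have int1 := le_product_integral mF1 mF1 F10 F10 eta0 alpha20 av0 alpha20 av0
  intF1 intF1 PA2 PB2.
have int2 := le_product_integral mF2 mF2 F20 F20 eta0 (lexx 0) M0 (lexx 0) M0
  intF2 intF2 PA2 PB2.
have pointwise w : (dec (received Er w.1.1.1 w.1.1.2 (fun i => Z' i w.1.2)
      (fun i => Z' i w.2)) - w.1.1.1 * w.1.1.2) ^+ 2 <=
    (1 + s) * G1 w + 2 * s * K * G2 w.
  rewrite decE erased_decoding// /Z' /c.
  rewrite (decoding_identity _ _ _ _ _ (lt0r_neq0 s0) w0E w1E).
  rewrite /G1 /F1 /= -exprMn; set m := _ * _.
  set e := \sum_i _.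
  have e2 : e ^+ 2 <= K * G2 w.
    apply: residual_bound => // i.
    have p01 : 0 <= p <= 1.
      by case/andP: alpha01 => a0 a1; rewrite /p; apply/andP; split; nra.
    have s301 : 0 <= s ^+ 3 <= 1.
      by rewrite exprn_ge0 ?(ltW s0)// exprn_ile1 ?(ltW s0).
    apply: le_trans (WP Er i); apply: normD_weighted_le => //.
    case/andP: p01 => p0 p1; case/andP: s301 => s30 s31.
    by rewrite mulr_ge0// mulr_ile1.
  by rewrite -(mulrA _ K); exact: sqr_perturbed_le.
have sK0 : 0 <= 2 * s * K.
  by apply: mulr_ge0 => //; apply: mulr_ge0 => //; exact: ltW.
have s10 : 0 <= 1 + s by rewrite addr_ge0// ltW.
have mf1 : measurable_fun [set: ((R * R) * Om) * Om] (fun w => ((1 + s) * G1 w)%:E).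
  by apply/measurable_EFinP/measurable_funM.
have mf2 : measurable_fun [set: ((R * R) * Om) * Om] (fun w => (2 * s * K * G2 w)%:E).
  by apply/measurable_EFinP/measurable_funM.
have le_f : (\int[P4]_w ((dec (received Er w.1.1.1 w.1.1.2
      (fun i => Z' i w.1.2) (fun i => Z' i w.2)) - w.1.1.1 * w.1.1.2) ^+ 2)%:E
    <= \int[P4]_w (((1 + s) * G1 w)%:E + (2 * s * K * G2 w)%:E))%E.
  apply: ge0_le_integral => //.
  - by move=> w _; rewrite lee_fin sqr_ge0.
  - apply/measurable_EFinP/measurable_funX/measurable_funB; first exact: mdec.
    exact: measurable_funM.
  - exact: emeasurable_funD.
  - by move=> w _; rewrite -EFinD lee_fin; exact: pointwise.
apply: le_trans le_f _.
have f10 w : (0 <= ((1 + s) * G1 w)%:E)%E by rewrite lee_fin; exact: mulr_ge0.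
have f20 w : (0 <= (2 * s * K * G2 w)%:E)%E by rewrite lee_fin; exact: mulr_ge0.
rewrite ge0_integralD//.
have le1 := le_integralZ s10 mG1 G10 int1.
have le2 := le_integralZ sK0 mG2 G20 int2.
apply: le_trans (leeD le1 le2) _.
rewrite -EFinD lee_fin.
have -> : (1 - alpha) ^+ 2 * eta + alpha ^+ 2 * v = eta * v / (eta + v).
  by rewrite /alpha; field; rewrite gt_eqF.
have vgt : sigma_star_sq eps < v by rewrite ltrDl.
have := estimation_error_le eta0 sig0 vgt.
rewrite -[eta / sigma_star_sq eps]/(SNR_star eta eps).
rewrite (_ : v - _ = delta); last by rewrite /v; ring.
have f_le : eta * v / (eta + v) <= eta.
  by rewrite ler_pdivrMr//; apply: ler_wpM2l => //; rewrite lerDr.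
have f_ge : 0 <= eta * v / (eta + v) by rewrite divr_ge0 ?mulr_ge0// ltW.
have dE : 2 * eta * delta <= gamma / 4.
  have -> : gamma / 4 = 2 * (eta + 1) * delta.
    by rewrite /delta; field; rewrite gt_eqF// ltr_wpDl.
  by rewrite ler_pM2r// ler_pM2l// lerDl.
move: f_le f_ge sB; rewrite /Bd; set h := eta * v / _; set tgt := eta ^+ 2 / _.
rewrite mul0r add0r => f_le f_ge sB htgt.
have h2 : h * h <= eta * eta by rewrite ler_pM.
have sh : s * (h * h) <= s * (eta * eta) by rewrite ler_wpM2l// ltW.
move: sB htgt; rewrite !expr2; nra.
Qed.
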